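(* Let $\mathbb K$ be a field with $\mathrm{char}\,\mathbb K\neq2$. The symmetric monoidal category $(\mathbb Z\text{-}\mathbf{GrAlg},\circ)$ of $\mathbb Z$-graded $\mathbb K$-algebras with the Manin product $\circ$ is coclosed relative to its full subcategory $\mathbf{FQA}$ of finitely generated (connected) quadratic algebras; that is, for each $\mathcal B\in\mathbf{FQA}$ the functor $-\circ\mathcal B\colon\mathbb Z\text{-}\mathbf{GrAlg}\to\mathbb Z\text{-}\mathbf{GrAlg}$ has a left adjoint relative to $\mathbf{FQA}$.
   Context: $\mathbb Z\text{-}\mathbf{GrAlg}$: objects are $\mathbb Z$-graded associative unital $\mathbb K$-algebras $\mathcal A=\bigoplus_{k\in\mathbb Z}\mathcal A_k$; morphisms are grading-preserving algebra homomorphisms. The Manin product $\mathcal A\circ\mathcal B$ is the $\mathbb Z$-graded vector space with components $(\mathcal A\circ\mathcal B)_k=\mathcal A_k\otimes\mathcal B_k$ and multiplication $(a_k\otimes b_k)(a'_l\otimes b'_l)=(a_ka'_l)\otimes(b_kb'_l)$ for $a_k\in\mathcal A_k,a'_l\in\mathcal A_l,b_k\in\mathcal B_k,b'_l\in\mathcal B_l$; on morphisms it is the componentwise tensor product. $\mathbf{FQA}$ is the full subcategory of ($\mathbb N_0$-graded) algebras isomorphic to $TW/(S)$, where $W$ is a finite-dimensional vector space placed in degree 1, $TW$ its tensor algebra, $S\subset W\otimes W$ a subspace and $(S)$ the two-sided ideal generated by $S$ (the components of negative degree are zero). For a functor $G\colon\mathbf D\to\mathbf C$ and a full subcategory $\mathbf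 C'\subset\mathbf C$, a left adjoint for $G$ relative to $\mathbf C'$ is a functor $F\colon\mathbf C'\to\mathbf D$ together with bijections $\mathrm{Hom}_{\mathbf D}(FX,Z)\cong\mathrm{Hom}_{\mathbf C}(X,GZ)$ natural in $X\in\mathbf C'$, $Z\in\mathbf D$. A symmetric monoidal category $(\mathbf C,\otimes)$ is coclosed relative to a full subcategory $\mathbf P\subset\mathbf C$ if for each $V\in\mathbf P$ the functor $-\otimes V\colon\mathbf C\to\mathbf C$ has a left adjoint relative to $\mathbf P$. *)

(* Defs.v *)
From HB Require Import structures.
From mathcomp Require Import all_boot all_order all_algebra.
From mathcomp Require Import generic_quotient ring_quotient.
From mathcomp Require Import boolp finmap.
From mathcomp Require Import monalg.

Set Implicit Arguments.
Unset Strict Implicit.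
Unset Printing Implicit Defensive.

Import GRing.Theory.

Local Open Scope ring_scope.
Local Open Scope quotient_scope.

Record category := Category {
  obj :> Type;
  hom : obj -> obj -> Type;
  idm : forall X, hom X X;
  comp : forall X Y Z, hom Y Z -> hom X Y -> hom X Z;
  comp_idl : forall X Y (f : hom X Y), comp (idm Y) f = f;
  comp_idr : forall X Y (f : hom X Y), comp f (idm X) = f;
  compA : forall X Y Z T (h : hom Z T) (g : hom Y Z) (f : hom X Y),
    comp h (comp g f) = comp (comp h g) f }.

Arguments hom {c} X Y.
Arguments idm {c} X.
Arguments comp {c X Y Z} g f.

Declare Scope cat_scope.
Local Open Scope cat_scope.
Notation "g '\c' f" := (comp g f) (at level 50, left associativity) : cat_scope.

Record functor (C D : category) := Functor {
  fobj :> C -> D;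
  fmor : forall X Y, hom X Y -> hom (fobj X) (fobj Y);
  fmor_id : forall X, fmor (idm X) = idm (fobj X);
  fmor_comp : forall X Y Z (g : hom Y Z) (f : hom X Y),
    fmor (g \c f) = fmor g \c fmor f }.

Arguments fmor {C D} F {X Y} f : rename.

Definition full_subcategory (C : category) (P : C -> Prop) : category :=
  {| obj := {X : C | P X};
     hom X Y := hom (sval X) (sval Y);
     idm X := idm (sval X);
     comp X Y Z g f := g \c f;
     comp_idl X Y f := comp_idl f;
     comp_idr X Y f := comp_idr f;
     compA X Y Z T h g f := compA h g f |}.

Record relative_left_adjoint (C D : category) (G : functor D C)
    (P : C -> Prop) := RelativeLeftAdjoint {
  rla_functor :> functor (full_subcategory P) D;
  rla_map : forall (X : full_subcategory P) (Z : D),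
    hom (rla_functor X) Z -> hom (sval X) (G Z);
  rla_bij : forall X Z, bijective (@rla_map X Z);
  rla_natural : forall (X X' : full_subcategory P) (Z Z' : D)
      (f : hom X' X) (g : hom Z Z') (h : hom (rla_functor X) Z),
    rla_map (g \c h \c fmor rla_functor f)
    = fmor G g \c rla_map h \c (f : hom (sval X') (sval X)) }.

Definition inverse_pair (C : category) (X Y : C) (f : hom X Y) (g : hom Y X) :=
  g \c f = idm X /\ f \c g = idm Y.

Definition isomorphic (C : category) (X Y : C) :=
  exists (f : hom X Y) (g : hom Y X), inverse_pair f g.

Record symmetric_monoidal_category := SymmetricMonoidalCategory {
  smc_cat :> category;
  tob : smc_cat -> smc_cat -> smc_cat;
  tmor : forall X X' Y Y', hom X X' -> hom Y Y' -> hom (tob X Y) (tob X' Y');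
  tmor_id : forall X Y, tmor (idm X) (idm Y) = idm (tob X Y);
  tmor_comp : forall X X' X'' Y Y' Y'' (f' : hom X' X'') (f : hom X X')
      (g' : hom Y' Y'') (g : hom Y Y'),
    tmor (f' \c f) (g' \c g) = tmor f' g' \c tmor f g;
  tunit : smc_cat;
  assoc : forall X Y Z, hom (tob (tob X Y) Z) (tob X (tob Y Z));
  assoc_inv : forall X Y Z, hom (tob X (tob Y Z)) (tob (tob X Y) Z);
  assoc_iso : forall X Y Z, inverse_pair (assoc X Y Z) (assoc_inv X Y Z);
  assoc_natural : forall X X' Y Y' Z Z'
      (f : hom X X') (g : hom Y Y') (h : hom Z Z'),
    assoc X' Y' Z' \c tmor (tmor f g) h = tmor f (tmor g h) \c assoc X Y Z;
  lunit : forall X, hom (tob tunit X) X;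
  lunit_inv : forall X, hom X (tob tunit X);
  lunit_iso : forall X, inverse_pair (lunit X) (lunit_inv X);
  lunit_natural : forall X X' (f : hom X X'),
    lunit X' \c tmor (idm tunit) f = f \c lunit X;
  runit : forall X, hom (tob X tunit) X;
  runit_inv : forall X, hom X (tob X tunit);
  runit_iso : forall X, inverse_pair (runit X) (runit_inv X);
  runit_natural : forall X X' (f : hom X X'),
    runit X' \c tmor f (idm tunit) = f \c runit X;
  braid : forall X Y, hom (tob X Y) (tob Y X);
  braid_natural : forall X X' Y Y' (f : hom X X') (g : hom Y Y'),
    braid X' Y' \c tmor f g = tmor g f \c braid X Y;
  braid_sym : forall X Y, braid Y X \c braid X Y = idm (tob X Y);
  pentagon : forall X Y Z T,
    assoc X Y (tob Z T) \c assoc (tob X Y) Z T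
    = tmor (idm X) (assoc Y Z T) \c assoc X (tob Y Z) T
        \c tmor (assoc X Y Z) (idm T);
  triangle : forall X Y,
    tmor (idm X) (lunit Y) \c assoc X tunit Y = tmor (runit X) (idm Y);
  hexagon : forall X Y Z,
    assoc Y Z X \c braid X (tob Y Z) \c assoc X Y Z
    = tmor (idm Y) (braid X Z) \c assoc Y X Z \c tmor (braid X Y) (idm Z) }.

Lemma tmor_idr_comp (M : symmetric_monoidal_category) (V X Y Z : M)
    (g : hom Y Z) (f : hom X Y) :
  tmor (g \c f) (idm V) = tmor g (idm V) \c tmor f (idm V).
Proof. by rewrite -tmor_comp comp_idl. Qed.

Definition tensor_right (M : symmetric_monoidal_category) (V : M) :
    functor M M :=
  {| fobj X := tob X V;
     fmor X Y f := tmor f (idm V);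
     fmor_id X := tmor_id X V;
     fmor_comp X Y Z g f := tmor_idr_comp V g f |}.

Definition coclosed_relative (M : symmetric_monoidal_category)
    (P : M -> Prop) : Prop :=
  forall V : M, P V -> inhabited (relative_left_adjoint (tensor_right V) P).

Arguments coclosed_relative M P : clear implicits.

Lemma linD (K : fieldType) (U V : lmodType K) (f : U -> V) :
  linear f -> {morph f : x y / x + y}.
Proof. by move=> lf x y; have := lf 1 x y; rewrite !scale1r. Qed.

Lemma lin0 (K : fieldType) (U V : lmodType K) (f : U -> V) : linear f -> f 0 = 0.
Proof. by move=> lf; have := lf (-1) 0 0; rewrite !scaleN1r !addNr. Qed.

Lemma linZ (K : fieldType) (U V : lmodType K) (f : U -> V) :
  linear f -> forall a x, f (a *: x) = a *: f x.
Proof. by move=> lf a x; have := lf a x 0; rewrite (lin0 lf) !addr0. Qed.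

Lemma linN (K : fieldType) (U V : lmodType K) (f : U -> V) :
  linear f -> forall x, f (- x) = - f x.
Proof. by move=> lf x; rewrite -scaleN1r linZ // scaleN1r. Qed.

Section Span.
Variables (K : fieldType) (V : lmodType K) (G : V -> Prop).

Inductive in_span : V -> Prop :=
| in_span0 : in_span 0
| in_span_cons a x y : G x -> in_span y -> in_span (a *: x + y).

Definition span_mem : V -> bool := fun x => `[< in_span x >].

Lemma span_gen x : G x -> in_span x.
Proof.
move=> Gx; rewrite -[x]scale1r -[_ *: _]addr0.
by apply: in_span_cons => //; apply: in_span0.
Qed.

Lemma span_closed : submod_closed span_mem.
Proof.
split; first by apply/asboolP; apply: in_span0.
move=> a x y /asboolP hx /asboolP hy; apply/asboolP.
elim: hx => [|b u v Gu _ IH]; first by rewrite scaler0 add0r.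
by rewrite scalerDr scalerA -addrA; apply: in_span_cons.
Qed.

HB.instance Definition _ := GRing.isSubmodClosed.Build K V span_mem span_closed.

Definition span : submodClosed V := GRing.SubmodClosed.clone K V span_mem _.

Lemma mem_span x : G x -> x \in span.
Proof. by move=> Gx; apply/asboolP; apply: span_gen. Qed.

Lemma in_spanP x : x \in span -> in_span x.
Proof. by move=> /asboolP. Qed.

End Span.

Section QuotientModule.
Variables (K : fieldType) (V : lmodType K) (I : submodClosed V).

(* The library derives closure under opposite from [submodClosed] only for
   explicit instances, so [Quotient.quot] is fed this alias of [I]. *)
Definition sub_mem : V -> bool := fun x => x \in I.

HB.instance Definition _ := GRing.isZmodClosed.Build V sub_mem
  (GRing.submod_closedB (GRing.submodClosedP I)).

Definition quot_type : Type :=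
  Quotient.quot (GRing.ZmodClosed.clone V sub_mem _).

HB.instance Definition _ := GRing.Zmodule.on quot_type.

Let pi (x : V) : quot_type := \pi_(Quotient.quot _) x.
Let rep (x : quot_type) : V := repr (x : Quotient.quot _).

Let repK : cancel rep pi.
Proof. exact: reprK. Qed.

Let piE x y : (pi x = pi y) <-> (x - y \in I).
Proof.
rewrite -[x - y \in I]/(x - y \in (sub_mem : pred V)) Quotient.idealrBE.
split; first by move=> e; apply/eqP.
by move=> /eqP.
Qed.

Let piD : {morph pi : x y / x + y}.
Proof. by move=> x y; rewrite /pi raddfD. Qed.

Definition quot_scale (a : K) (x : quot_type) : quot_type := pi (a *: rep x).

Let piZ a x : pi (a *: x) = quot_scale a (pi x).
Proof. by apply/piE; rewrite -scalerBr; apply: rpredZ; apply/piE; rewrite repK. Qed.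

Fact quot_scaleA a b x : quot_scale a (quot_scale b x) = quot_scale (a * b) x.
Proof. by rewrite -[x]repK -!piZ scalerA. Qed.

Fact quot_scale1 : left_id 1 quot_scale.
Proof. by move=> x; rewrite -[x]repK -!piZ scale1r. Qed.

Fact quot_scaleDr : right_distributive quot_scale +%R.
Proof. by move=> a x y; rewrite -[x]repK -[y]repK -piD -!piZ -piD scalerDr. Qed.

Fact quot_scaleDl x : {morph quot_scale^~ x : a b / a + b}.
Proof. by move=> a b /=; rewrite -[x]repK -!piZ -piD scalerDl. Qed.

HB.instance Definition _ := GRing.Zmodule_isLmodule.Build K quot_type
  quot_scaleA quot_scale1 quot_scaleDr quot_scaleDl.

(* The quotient space, its projection and a section of the latter, locked
   together so that unification never unfolds the construction. *)
Record quot_data := QuotData {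
  quot_data_space : lmodType K;
  quot_data_pi : V -> quot_data_space;
  quot_data_repr : quot_data_space -> V }.

Fact quot_key : unit. Proof. by []. Qed.

Definition quot_pack : quot_data :=
  locked_with quot_key (@QuotData quot_type pi rep).

Definition quotmod : lmodType K := quot_data_space quot_pack.
Definition quot_pi : V -> quotmod := @quot_data_pi quot_pack.
Definition quot_repr : quotmod -> V := @quot_data_repr quot_pack.

Let quot_packP (P : quot_data -> Prop) :
  P (@QuotData quot_type pi rep) -> P quot_pack.
Proof. by rewrite /quot_pack unlock. Qed.

Lemma quot_reprK : cancel quot_repr quot_pi.
Proof.
exact: (@quot_packP (fun d => cancel (@quot_data_repr d) (@quot_data_pi d)) repK).
Qed.

Lemma quot_piE x y : (quot_pi x = quot_pi y) <-> (x - y \in I).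
Proof.
apply: (@quot_packP (fun d =>
  (quot_data_pi d x = quot_data_pi d y) <-> (x - y \in I))).
exact: piE.
Qed.

Lemma quot_pi_linear : linear quot_pi.
Proof.
apply: (@quot_packP (fun d => linear (@quot_data_pi d))) => a x y /=.
by rewrite piD piZ.
Qed.

End QuotientModule.

Arguments quot_pi {K V} I x.
Arguments quot_repr {K V} I x.

Section Tensor.
Variables (K : fieldType) (V W : lmodType K).

(* The vector space with basis [V * W]; [<< (v, w) >>] is the basis vector of
   the pair [(v, w)]. *)
Definition free_pairs : lmodType K := {malg K[(V * W)%type]}.

Inductive tens_rel : free_pairs -> Prop :=
| tens_rel_l a v v' w :
    tens_rel (<< (a *: v + v', w) >> - a *: << (v, w) >> - << (v', w) >>)
| tens_rel_r a v w w' :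
    tens_rel (<< (v, a *: w + w') >> - a *: << (v, w) >> - << (v, w') >>).

Definition tens : lmodType K := quotmod (span tens_rel).

(* Locked, like [tens_lift] below, to keep unification from unfolding it. *)
Fact tens_key : unit. Proof. by []. Qed.

Definition tpure : V -> W -> tens :=
  locked_with tens_key (fun v w => quot_pi (span tens_rel) << (v, w) >>).

Lemma tpure_def v w : tpure v w = quot_pi (span tens_rel) << (v, w) >>.
Proof. by rewrite /tpure unlock. Qed.

End Tensor.

Notation "v ⊗ w" := (tpure v w) (at level 40, left associativity).

Definition bilin (K : fieldType) (V W U : lmodType K) (f : V -> W -> U) : Prop :=
  (forall w, linear (f^~ w)) /\ (forall v, linear (f v)).

Section TensorTheory.
Variables (K : fieldType) (V W : lmodType K).

Lemma tpure_bilin : bilin (@tpure K V W).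
Proof.
split=> [w a v v'|v a w w']; rewrite !tpure_def.
- transitivity (quot_pi (span (@tens_rel K V W)) (a *: << (v, w) >> + << (v', w) >>));
    last exact: quot_pi_linear.
  by apply/quot_piE; rewrite opprD addrA; apply: mem_span; apply: tens_rel_l.
- transitivity (quot_pi (span (@tens_rel K V W)) (a *: << (v, w) >> + << (v, w') >>));
    last exact: quot_pi_linear.
  by apply/quot_piE; rewrite opprD addrA; apply: mem_span; apply: tens_rel_r.
Qed.

Section FreeLift.
Variables (U : lmodType K) (f : V -> W -> U).

Definition free_lift (g : free_pairs V W) : U :=
  \sum_(k <- msupp g) g@_k *: f k.1 k.2.

Lemma free_liftEw (d : {fset (V * W)%type}) (g : free_pairs V W) :
  (msupp g `<=` d)%fset -> free_lift g = \sum_(k <- d) g@_k *: f k.1 k.2.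
Proof.
move=> le; rewrite /free_lift (big_fset_incl _ le) => //= x xd /mcoeff_outdom ->.
by rewrite scale0r.
Qed.

Lemma free_liftU v w : free_lift << (v, w) >> = f v w.
Proof. by rewrite (free_liftEw msuppU_le) big_seq_fset1 mcoeffUU scale1r. Qed.

Lemma free_lift_linear : linear free_lift.
Proof.
move=> a g h.
pose d := (msupp g `|` msupp h `|` msupp (a *: g + h))%fset.
rewrite !(@free_liftEw d) /d; first last.
- by rewrite fsubsetUr.
- by rewrite -fsetUA fsubsetUl.
- by rewrite fsetUAC fsubsetUr.
rewrite scaler_sumr -big_split /=; apply: eq_bigr => k _.
by rewrite mcoeffD mcoeffZ scalerDl scalerA.
Qed.

(* Evaluates the linear extension of [f] to [free_pairs V W] on a
   representative; it is the linear map induced by [f] when [f] is bilinear,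
   and carries no meaning otherwise. *)
Definition tens_lift : tens V W -> U :=
  locked_with tens_key (fun x => free_lift (quot_repr _ x)).

Hypothesis bf : bilin f.

Lemma free_lift_span g : in_span (@tens_rel K V W) g -> free_lift g = 0.
Proof.
have lf := free_lift_linear.
elim=> [|a x y hx _ IH]; first exact: lin0 lf.
rewrite lf IH addr0; case: hx => [b v v' w|b v w w'];
  rewrite !(linD lf) !(linN lf) (linZ lf) !free_liftU.
- by rewrite (bf.1 w) -addrA -opprD addrN scaler0.
- by rewrite (bf.2 v) -addrA -opprD addrN scaler0.
Qed.

Lemma tens_lift_pi g : tens_lift (quot_pi _ g) = free_lift g.
Proof.
have lf := free_lift_linear.
rewrite /tens_lift unlock; apply/eqP; rewrite -subr_eq0 -(linN lf) -(linD lf).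
apply/eqP; apply: free_lift_span; apply: in_spanP.
by apply/quot_piE; rewrite quot_reprK.
Qed.

Lemma tens_liftE v w : tens_lift (v ⊗ w) = f v w.
Proof. by rewrite tpure_def tens_lift_pi free_liftU. Qed.

Lemma tens_lift_linear : linear tens_lift.
Proof.
move=> a x y; rewrite -[x]quot_reprK -[y]quot_reprK -quot_pi_linear.
by rewrite !tens_lift_pi free_lift_linear.
Qed.

Lemma tens_liftD : {morph tens_lift : x y / x + y}.
Proof. exact: linD tens_lift_linear. Qed.

End FreeLift.

Lemma tens_ind (P : tens V W -> Prop) :
  (forall v w, P (v ⊗ w)) -> (forall x y, P x -> P y -> P (x + y)) ->
  forall x, P x.
Proof.
move=> Ppure PD x; rewrite -[x]quot_reprK.
have P0 : P 0 by rewrite -(lin0 (tpure_bilin.1 0)); apply: Ppure.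
have PZ a v w : P (a *: (v ⊗ w)).
  by rewrite -(linZ (tpure_bilin.1 w)); apply: Ppure.
pose pi := quot_pi (span (@tens_rel K V W)).
have lpi : linear pi by apply: quot_pi_linear.
rewrite -[quot_pi _ _]/(pi _) (monalgE (quot_repr _ x)).
set r := enum_fset _; elim: (r) => [|k r' IH].
  by rewrite big_nil (lin0 lpi).
rewrite big_cons (linD lpi); apply: (PD _ _ _ IH).
rewrite (_ : << _ *g k >> = (quot_repr _ x)@_k *: << k >> :> free_pairs V W).
  by rewrite (linZ lpi); case: (k) => v w; rewrite /pi -tpure_def; apply: PZ.
by apply/malgP => k'; rewrite mcoeffZ !mcoeffU mulr_natr.
Qed.

End TensorTheory.

Lemma tens_lift_param (K : fieldType) (V W U Z : lmodType K)
    (F : Z -> V -> W -> U) (x : tens V W) :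
  (forall z, bilin (F z)) -> (forall v w, linear (fun z => F z v w)) ->
  linear (fun z => tens_lift (F z) x).
Proof.
move=> bF lF c z z'; elim/tens_ind: x => [v w|x y IHx IHy].
  by rewrite !tens_liftE //; apply: lF.
by rewrite !tens_liftD // IHx IHy scalerDr addrACA.
Qed.

Lemma tpureDl (K : fieldType) (V W : lmodType K) (v v' : V) (w : W) :
  (v + v') ⊗ w = v ⊗ w + v' ⊗ w.
Proof. exact: linD ((tpure_bilin V W).1 w) v v'. Qed.

Lemma tpureDr (K : fieldType) (V W : lmodType K) (v : V) (w w' : W) :
  v ⊗ (w + w') = v ⊗ w + v ⊗ w'.
Proof. exact: linD ((tpure_bilin V W).2 v) w w'. Qed.

Lemma tpureZl (K : fieldType) (V W : lmodType K) a (v : V) (w : W) :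
  (a *: v) ⊗ w = a *: (v ⊗ w).
Proof. exact: linZ ((tpure_bilin V W).1 w) a v. Qed.

Lemma tpureZr (K : fieldType) (V W : lmodType K) a (v : V) (w : W) :
  v ⊗ (a *: w) = a *: (v ⊗ w).
Proof. exact: linZ ((tpure_bilin V W).2 v) a w. Qed.

Definition tpureE := (tpureDl, tpureDr, tpureZl, tpureZr).

(* The graded algebra is the direct sum of its components [A k].  The product
   of degrees [k] and [l] takes values in [A m] for any [m] equipped with a
   proof [e] of [k + l = m]; equality on [int] being decidable, [e] is
   irrelevant and only serves to avoid transports between components. *)
Record gralg (K : fieldType) := GrAlg {
  grcomp :> int -> lmodType K;
  gmul : forall k l m : int, k + l = m -> grcomp k -> grcomp l -> grcomp m;
  gone : grcomp 0;
  gmul_bilin : forall k l m (e : k + l = m), bilin (gmul e);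
  gmulA : forall k l m kl lm klm (e1 : k + l = kl) (e2 : kl + m = klm)
      (e3 : l + m = lm) (e4 : k + lm = klm) a b c,
    gmul e2 (gmul e1 a b) c = gmul e4 a (gmul e3 b c);
  gmul1l : forall k (e : 0 + k = k) a, gmul e gone a = a;
  gmul1r : forall k (e : k + 0 = k) a, gmul e a gone = a }.

Arguments gmul {K A k l m} e a b : rename.
Arguments gone {K A} : rename.
Arguments gmul_bilin {K A k l m} e : rename.
Arguments gmulA {K A k l m kl lm klm} e1 e2 e3 e4 a b c : rename.
Arguments gmul1l {K A k} e a : rename.
Arguments gmul1r {K A k} e a : rename.

Section GrAlgTheory.
Variables (K : fieldType) (A : gralg K) (k l m : int) (e : k + l = m).

Lemma gmulDl (a a' : A k) (b : A l) : gmul e (a + a') b = gmul e a b + gmul e a' b.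
Proof. exact: linD ((gmul_bilin e).1 b) a a'. Qed.

Lemma gmulDr (a : A k) (b b' : A l) : gmul e a (b + b') = gmul e a b + gmul e a b'.
Proof. exact: linD ((gmul_bilin e).2 a) b b'. Qed.

Lemma gmulZl c (a : A k) (b : A l) : gmul e (c *: a) b = c *: gmul e a b.
Proof. exact: linZ ((gmul_bilin e).1 b) c a. Qed.

Lemma gmulZr c (a : A k) (b : A l) : gmul e a (c *: b) = c *: gmul e a b.
Proof. exact: linZ ((gmul_bilin e).2 a) c b. Qed.

End GrAlgTheory.

Definition gmulE := (gmulDl, gmulDr, gmulZl, gmulZr).

Record grhom (K : fieldType) (A B : gralg K) := GrHom {
  grfun :> forall k, A k -> B k;
  grfun_linear : forall k, linear (@grfun k);
  grfunM : forall k l m (e : k + l = m) a b,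
    grfun (gmul e a b) = gmul e (grfun a) (grfun b);
  grfun1 : grfun gone = gone }.

Section GrHomTheory.
Variable K : fieldType.

Lemma grhomP (A B : gralg K) (f g : grhom A B) :
  (forall k (x : A k), f k x = g k x) -> f = g.
Proof.
case: f g => [f lf Mf f1] [g lg Mg g1] /= fg.
have {}fg : f = g by apply: functional_extensionality_dep => k; apply: funext.
move: lf Mf f1; rewrite fg => lf Mf f1.
by congr GrHom; apply: Prop_irrelevance.
Qed.

Lemma grfunD (A B : gralg K) (f : grhom A B) k (x y : A k) :
  f k (x + y) = f k x + f k y.
Proof. exact: linD (grfun_linear f (k := k)) x y. Qed.

Definition grid (A : gralg K) : grhom A A :=
  {| grfun k x := x;
     grfun_linear k a x y := erefl;
     grfunM k l m e a b := erefl;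
     grfun1 := erefl |}.

Section Composition.
Variables (A B C : gralg K) (g : grhom B C) (f : grhom A B).

Definition grcompose_fun k (x : A k) : C k := g k (f k x).

Lemma grcompose_linear k : linear (@grcompose_fun k).
Proof. by move=> a x y; rewrite /grcompose_fun !grfun_linear. Qed.

Lemma grcomposeM k l m (e : k + l = m) a b :
  grcompose_fun (gmul e a b) = gmul e (grcompose_fun a) (grcompose_fun b).
Proof. by rewrite /grcompose_fun !grfunM. Qed.

Lemma grcompose1 : grcompose_fun gone = gone.
Proof. by rewrite /grcompose_fun !grfun1. Qed.

Definition grcompose : grhom A C :=
  GrHom grcompose_linear grcomposeM grcompose1.

End Composition.

Lemma grcompose_idl A B (f : grhom A B) : grcompose (grid B) f = f.
Proof. exact: grhomP. Qed.

Lemma grcompose_idr A B (f : grhom A B) : grcompose f (grid A) = f.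
Proof. exact: grhomP. Qed.

Lemma grcomposeA A B C D (h : grhom C D) (g : grhom B C) (f : grhom A B) :
  grcompose h (grcompose g f) = grcompose (grcompose h g) f.
Proof. exact: grhomP. Qed.

Definition GrAlgCat : category :=
  Category grcompose_idl grcompose_idr grcomposeA.

End GrHomTheory.

Section Manin.
Variable K : fieldType.
Implicit Types A B C D : gralg K.

Section Product.
Variables A B : gralg K.

Definition manin_comp (k : int) : lmodType K := tens (A k) (B k).

Definition manin_mul k l m (e : k + l = m) (x : manin_comp k) (y : manin_comp l) :
    manin_comp m :=
  tens_lift (fun a b =>
    tens_lift (fun a' b' => gmul e a a' ⊗ gmul e b b') y) x.

Lemma manin_bilin_in k l m (e : k + l = m) (a : A k) (b : B k) :
  bilin (fun (a' : A l) (b' : B l) => gmul e a a' ⊗ gmul e b b').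
Proof. by split=> [b'|a'] c x y; rewrite !gmulE !tpureE. Qed.

Lemma manin_bilin_out k l m (e : k + l = m) (y : manin_comp l) :
  bilin (fun (a : A k) (b : B k) =>
    tens_lift (fun a' b' => gmul e a a' ⊗ gmul e b b') y).
Proof.
split=> [b|a]; apply: tens_lift_param; try by move=> *; apply: manin_bilin_in.
- by move=> a' b' c x x'; rewrite !gmulE !tpureE.
- by move=> a' b' c x x'; rewrite !gmulE !tpureE.
Qed.

Lemma manin_mulE k l m (e : k + l = m) a b a' b' :
  manin_mul e (a ⊗ b) (a' ⊗ b') = gmul e a a' ⊗ gmul e b b'.
Proof.
rewrite /manin_mul tens_liftE; last exact: manin_bilin_out.
by rewrite tens_liftE //; apply: manin_bilin_in.
Qed.

Lemma manin_mul_bilin k l m (e : k + l = m) : bilin (manin_mul e).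
Proof.
split=> [y|x]; first by apply: tens_lift_linear; apply: manin_bilin_out.
move=> c y y'; elim/tens_ind: x => [a b|x x' IHx IHx'].
  rewrite /manin_mul !tens_liftE; try exact: manin_bilin_out.
  by apply: tens_lift_linear; apply: manin_bilin_in.
rewrite /manin_mul !(tens_liftD (manin_bilin_out e _)).
by rewrite -!/(manin_mul e _ _) IHx IHx' scalerDr addrACA.
Qed.

Lemma manin_mulDl k l m (e : k + l = m) x x' y :
  manin_mul e (x + x') y = manin_mul e x y + manin_mul e x' y.
Proof. exact: linD ((manin_mul_bilin e).1 y) x x'. Qed.

Lemma manin_mulDr k l m (e : k + l = m) x y y' :
  manin_mul e x (y + y') = manin_mul e x y + manin_mul e x y'.
Proof. exact: linD ((manin_mul_bilin e).2 x) y y'. Qed.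

Lemma manin_mulA k l m kl lm klm (e1 : k + l = kl) (e2 : kl + m = klm)
    (e3 : l + m = lm) (e4 : k + lm = klm) x y z :
  manin_mul e2 (manin_mul e1 x y) z = manin_mul e4 x (manin_mul e3 y z).
Proof.
elim/tens_ind: x => [a b|x x' IHx IHx']; last first.
  by rewrite !manin_mulDl IHx IHx'.
elim/tens_ind: y => [a' b'|y y' IHy IHy']; last first.
  by rewrite !(manin_mulDr, manin_mulDl) IHy IHy'.
elim/tens_ind: z => [a'' b''|z z' IHz IHz']; last first.
  by rewrite !manin_mulDr IHz IHz'.
by rewrite !manin_mulE !(gmulA e1 e2 e3 e4).
Qed.

Lemma manin_mul1l k (e : 0 + k = k) x : manin_mul e (gone ⊗ gone) x = x.
Proof.
elim/tens_ind: x => [a b|x y IHx IHy]; first by rewrite manin_mulE !gmul1l.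
by rewrite manin_mulDr IHx IHy.
Qed.

Lemma manin_mul1r k (e : k + 0 = k) x : manin_mul e x (gone ⊗ gone) = x.
Proof.
elim/tens_ind: x => [a b|x y IHx IHy]; first by rewrite manin_mulE !gmul1r.
by rewrite manin_mulDl IHx IHy.
Qed.

Definition manin : gralg K :=
  GrAlg manin_mul_bilin manin_mulA manin_mul1l manin_mul1r.

End Product.

Lemma maninE A B k l m (e : k + l = m) (a : A k) (b : B k) (a' : A l) (b' : B l) :
  gmul (A := manin A B) e (a ⊗ b) (a' ⊗ b') = gmul e a a' ⊗ gmul e b b'.
Proof. exact: manin_mulE. Qed.

Lemma grfunM_tens A B C (f : forall k, manin A B k -> C k) :
  (forall k, linear (@f k)) ->
  (forall k l m (e : k + l = m) (a : A k) (b : B k) (a' : A l) (b' : B l),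
    f m (gmul e a a' ⊗ gmul e b b') = gmul e (f k (a ⊗ b)) (f l (a' ⊗ b'))) ->
  forall k l m (e : k + l = m) x y,
    f m (gmul (A := manin A B) e x y) = gmul e (f k x) (f l y).
Proof.
move=> lf fM k l m e x y; have fD n := linD (lf n).
elim/tens_ind: x => [a b|x x' IHx IHx']; last by rewrite gmulDl !fD gmulDl IHx IHx'.
elim/tens_ind: y => [a' b'|y y' IHy IHy']; last by rewrite gmulDr !fD gmulDr IHy IHy'.
by rewrite maninE fM.
Qed.

Section Map.
Variables (A A' B B' : gralg K) (f : grhom A A') (g : grhom B B').

Definition manin_map_fun k : manin A B k -> manin A' B' k :=
  tens_lift (fun (a : A k) (b : B k) => f k a ⊗ g k b).

Lemma manin_map_bilin k : bilin (fun (a : A k) (b : B k) => f k a ⊗ g k b).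
Proof. by split=> [b|a] c x y; rewrite grfun_linear !tpureE. Qed.

Lemma manin_map_funE k (a : A k) (b : B k) :
  manin_map_fun (a ⊗ b : manin A B k) = f k a ⊗ g k b.
Proof. exact: tens_liftE (manin_map_bilin k) a b. Qed.

Lemma manin_map_linear k : linear (@manin_map_fun k).
Proof. exact: tens_lift_linear (manin_map_bilin k). Qed.

Lemma manin_mapM k l m (e : k + l = m) x y :
  manin_map_fun (gmul e x y) = gmul e (manin_map_fun x) (manin_map_fun y).
Proof.
move: k l m e x y; apply: grfunM_tens => [n|k l m e a b a' b'].
  exact: manin_map_linear.
by rewrite !manin_map_funE maninE !grfunM.
Qed.

Lemma manin_map1 : manin_map_fun gone = gone.
Proof. by rewrite manin_map_funE !grfun1. Qed.

Definition manin_map : grhom (manin A B) (manin A' B') :=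
  GrHom manin_map_linear manin_mapM manin_map1.

Lemma manin_mapE k (a : A k) (b : B k) : manin_map k (a ⊗ b) = f k a ⊗ g k b.
Proof. exact: manin_map_funE. Qed.

End Map.

Lemma manin_homP A B C (f g : grhom (manin A B) C) :
  (forall k (a : A k) (b : B k), f k (a ⊗ b) = g k (a ⊗ b)) -> f = g.
Proof.
move=> fg; apply: grhomP => k x; elim/tens_ind: x => [//|x y IHx IHy].
by rewrite !grfunD IHx IHy.
Qed.

(* The Laurent polynomial algebra in one variable of degree 1. *)
Definition unit_mul k l m (e : k + l = m :> int) (a b : K^o) : K^o := a * b.

Lemma unit_mul_bilin k l m (e : k + l = m) : bilin (unit_mul e).
Proof.
split=> [b|a] c x y; rewrite /unit_mul /GRing.scale /=.
- by rewrite mulrDl mulrA.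
- by rewrite mulrDr !mulrA [a * c]mulrC.
Qed.

Definition manin_unit : gralg K :=
  {| grcomp := fun=> K^o;
     gmul := unit_mul;
     gone := 1;
     gmul_bilin := unit_mul_bilin;
     gmulA k l m kl lm klm e1 e2 e3 e4 a b c := esym (mulrA (a : K) b c);
     gmul1l k e a := mul1r (a : K);
     gmul1r k e a := mulr1 (a : K) |}.

End Manin.

Section TensorIso.
Variables (K : fieldType) (U V W : lmodType K).

Definition tassoc : tens (tens U V) W -> tens U (tens V W) :=
  tens_lift (fun t w => tens_lift (fun u v => u ⊗ (v ⊗ w)) t).

Lemma tassoc_bilin_in w : bilin (fun (u : U) (v : V) => u ⊗ (v ⊗ (w : W))).
Proof. by split=> [v|u] c x y; rewrite !tpureE. Qed.

Lemma tassoc_bilin :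
  bilin (fun t (w : W) => tens_lift (fun (u : U) (v : V) => u ⊗ (v ⊗ w)) t).
Proof.
split=> [w|t]; first by apply: tens_lift_linear; apply: tassoc_bilin_in.
apply: tens_lift_param; first exact: tassoc_bilin_in.
by move=> u v c x y; rewrite !tpureE.
Qed.

Lemma tassoc_linear : linear tassoc.
Proof. exact: tens_lift_linear tassoc_bilin. Qed.

Lemma tassocE u v w : tassoc (u ⊗ v ⊗ w) = u ⊗ (v ⊗ w).
Proof.
by rewrite /tassoc !tens_liftE //; [exact: tassoc_bilin_in | exact: tassoc_bilin].
Qed.

Definition tassoc_inv : tens U (tens V W) -> tens (tens U V) W :=
  tens_lift (fun u t => tens_lift (fun v w => u ⊗ v ⊗ w) t).

Lemma tassoc_inv_bilin_in u : bilin (fun (v : V) (w : W) => (u : U) ⊗ v ⊗ w).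
Proof. by split=> [w|v] c x y; rewrite !tpureE. Qed.

Lemma tassoc_inv_bilin :
  bilin (fun (u : U) t => tens_lift (fun (v : V) (w : W) => u ⊗ v ⊗ w) t).
Proof.
split=> [t|u]; last by apply: tens_lift_linear; apply: tassoc_inv_bilin_in.
apply: tens_lift_param; first exact: tassoc_inv_bilin_in.
by move=> v w c x y; rewrite !tpureE.
Qed.

Lemma tassoc_inv_linear : linear tassoc_inv.
Proof. exact: tens_lift_linear tassoc_inv_bilin. Qed.

Lemma tassoc_invE u v w : tassoc_inv (u ⊗ (v ⊗ w)) = u ⊗ v ⊗ w.
Proof.
rewrite /tassoc_inv !tens_liftE //.
- exact: tassoc_inv_bilin_in.
- exact: tassoc_inv_bilin.
Qed.

Definition tswap : tens U V -> tens V U := tens_lift (fun u v => v ⊗ u).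

Lemma tswap_bilin : bilin (fun (u : U) (v : V) => v ⊗ u).
Proof. by split=> [v|u] c x y; rewrite !tpureE. Qed.

Lemma tswap_linear : linear tswap.
Proof. exact: tens_lift_linear tswap_bilin. Qed.

Lemma tswapE u v : tswap (u ⊗ v) = v ⊗ u.
Proof. exact: tens_liftE tswap_bilin u v. Qed.

Definition tscalel : tens K^o V -> V := tens_lift (fun (a : K^o) v => a *: v).

Lemma tscalel_bilin : bilin (fun (a : K^o) (v : V) => a *: v).
Proof.
split=> [v|a] c x y; first by rewrite scalerDl scalerA.
by rewrite scalerDr !scalerA mulrC.
Qed.

Lemma tscalel_linear : linear tscalel.
Proof. exact: tens_lift_linear tscalel_bilin. Qed.

Lemma tscalelE (a : K^o) v : tscalel (a ⊗ v) = a *: v.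
Proof. exact: tens_liftE tscalel_bilin a v. Qed.

Definition tscaler : tens V K^o -> V := tens_lift (fun v (a : K^o) => a *: v).

Lemma tscaler_bilin : bilin (fun (v : V) (a : K^o) => a *: v).
Proof. by split=> [a|v]; [exact: tscalel_bilin.2 | exact: tscalel_bilin.1]. Qed.

Lemma tscaler_linear : linear tscaler.
Proof. exact: tens_lift_linear tscaler_bilin. Qed.

Lemma tscalerE (a : K^o) v : tscaler (v ⊗ a) = a *: v.
Proof. exact: tens_liftE tscaler_bilin v a. Qed.

End TensorIso.

Section ManinSMC.
Variable K : fieldType.
Implicit Types A B C D : gralg K.

Section Assoc.
Variables A B C : gralg K.

Definition manin_assoc_fun k : manin (manin A B) C k -> manin A (manin B C) k :=
  @tassoc K (A k) (B k) (C k).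

Lemma manin_assoc_linear k : linear (@manin_assoc_fun k).
Proof. exact: tassoc_linear. Qed.

Lemma manin_assocM k l m (e : k + l = m) x y :
  manin_assoc_fun (gmul e x y) = gmul e (manin_assoc_fun x) (manin_assoc_fun y).
Proof.
have fD n := linD (@manin_assoc_linear n).
move: k l m e x y; apply: grfunM_tens => [n|k l m e x c y c'].
  exact: manin_assoc_linear.
elim/tens_ind: x => [a b|x x' IHx IHx']; last first.
  by rewrite gmulDl !tpureDl !fD IHx IHx' gmulDl.
elim/tens_ind: y => [a' b'|y y' IHy IHy']; last first.
  by rewrite gmulDr !tpureDl !fD IHy IHy' gmulDr.
by rewrite maninE /manin_assoc_fun !tassocE !maninE.
Qed.

Lemma manin_assoc1 : manin_assoc_fun gone = gone.
Proof. exact: tassocE. Qed.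

Definition manin_assoc : grhom (manin (manin A B) C) (manin A (manin B C)) :=
  GrHom manin_assoc_linear manin_assocM manin_assoc1.

Definition manin_assoc_inv_fun k :
    manin A (manin B C) k -> manin (manin A B) C k :=
  @tassoc_inv K (A k) (B k) (C k).

Lemma manin_assoc_inv_linear k : linear (@manin_assoc_inv_fun k).
Proof. exact: tassoc_inv_linear. Qed.

Lemma manin_assoc_invM k l m (e : k + l = m) x y :
  manin_assoc_inv_fun (gmul e x y)
  = gmul e (manin_assoc_inv_fun x) (manin_assoc_inv_fun y).
Proof.
have fD n := linD (@manin_assoc_inv_linear n).
move: k l m e x y; apply: grfunM_tens => [n|k l m e a x a' y].
  exact: manin_assoc_inv_linear.
elim/tens_ind: x => [b c|x x' IHx IHx']; last first.
  by rewrite gmulDl !tpureDr !fD IHx IHx' gmulDl.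
elim/tens_ind: y => [b' c'|y y' IHy IHy']; last first.
  by rewrite gmulDr !tpureDr !fD IHy IHy' gmulDr.
by rewrite maninE /manin_assoc_inv_fun !tassoc_invE !maninE.
Qed.

Lemma manin_assoc_inv1 : manin_assoc_inv_fun gone = gone.
Proof. exact: tassoc_invE. Qed.

Definition manin_assoc_inv : grhom (manin A (manin B C)) (manin (manin A B) C) :=
  GrHom manin_assoc_inv_linear manin_assoc_invM manin_assoc_inv1.

End Assoc.

Section BraidUnit.
Variables A B : gralg K.

Definition manin_braid_fun k : manin A B k -> manin B A k := @tswap K (A k) (B k).

Lemma manin_braid_linear k : linear (@manin_braid_fun k).
Proof. exact: tswap_linear. Qed.

Lemma manin_braidM k l m (e : k + l = m) x y :
  manin_braid_fun (gmul e x y) = gmul e (manin_braid_fun x) (manin_braid_fun y).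
Proof.
move: k l m e x y; apply: grfunM_tens => [n|k l m e a b a' b'].
  exact: manin_braid_linear.
by rewrite /manin_braid_fun !tswapE maninE.
Qed.

Lemma manin_braid1 : manin_braid_fun gone = gone.
Proof. exact: tswapE. Qed.

Definition manin_braid : grhom (manin A B) (manin B A) :=
  GrHom manin_braid_linear manin_braidM manin_braid1.

Definition manin_lunit_fun k : manin (manin_unit K) A k -> A k := @tscalel K (A k).

Lemma manin_lunit_linear k : linear (@manin_lunit_fun k).
Proof. exact: tscalel_linear. Qed.

Lemma manin_lunitM k l m (e : k + l = m) x y :
  manin_lunit_fun (gmul e x y) = gmul e (manin_lunit_fun x) (manin_lunit_fun y).
Proof.
move: k l m e x y; apply: grfunM_tens => [n|k l m e a b a' b'].
  exact: manin_lunit_linear.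
by rewrite /manin_lunit_fun !tscalelE gmulZl gmulZr scalerA.
Qed.

Lemma manin_lunit1 : manin_lunit_fun gone = gone.
Proof. by rewrite /manin_lunit_fun tscalelE scale1r. Qed.

Definition manin_lunit : grhom (manin (manin_unit K) A) A :=
  GrHom manin_lunit_linear manin_lunitM manin_lunit1.

Definition manin_lunit_inv_fun k (x : A k) : manin (manin_unit K) A k :=
  (1 : K^o) ⊗ x.

Lemma manin_lunit_inv_linear k : linear (@manin_lunit_inv_fun k).
Proof. by move=> c x y; rewrite /manin_lunit_inv_fun !tpureE. Qed.

Lemma manin_lunit_invM k l m (e : k + l = m) a b :
  manin_lunit_inv_fun (gmul e a b)
  = gmul e (manin_lunit_inv_fun a) (manin_lunit_inv_fun b).
Proof. by rewrite maninE /= /unit_mul mulr1. Qed.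

Definition manin_lunit_inv : grhom A (manin (manin_unit K) A) :=
  GrHom manin_lunit_inv_linear manin_lunit_invM erefl.

Definition manin_runit_fun k : manin A (manin_unit K) k -> A k := @tscaler K (A k).

Lemma manin_runit_linear k : linear (@manin_runit_fun k).
Proof. exact: tscaler_linear. Qed.

Lemma manin_runitM k l m (e : k + l = m) x y :
  manin_runit_fun (gmul e x y) = gmul e (manin_runit_fun x) (manin_runit_fun y).
Proof.
move: k l m e x y; apply: grfunM_tens => [n|k l m e b a b' a'].
  exact: manin_runit_linear.
by rewrite /manin_runit_fun !tscalerE gmulZl gmulZr scalerA.
Qed.

Lemma manin_runit1 : manin_runit_fun gone = gone.
Proof. by rewrite /manin_runit_fun tscalerE scale1r. Qed.

Definition manin_runit : grhom (manin A (manin_unit K)) A :=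
  GrHom manin_runit_linear manin_runitM manin_runit1.

Definition manin_runit_inv_fun k (x : A k) : manin A (manin_unit K) k :=
  x ⊗ (1 : K^o).

Lemma manin_runit_inv_linear k : linear (@manin_runit_inv_fun k).
Proof. by move=> c x y; rewrite /manin_runit_inv_fun !tpureE. Qed.

Lemma manin_runit_invM k l m (e : k + l = m) a b :
  manin_runit_inv_fun (gmul e a b)
  = gmul e (manin_runit_inv_fun a) (manin_runit_inv_fun b).
Proof. by rewrite maninE /= /unit_mul mulr1. Qed.

Definition manin_runit_inv : grhom A (manin A (manin_unit K)) :=
  GrHom manin_runit_inv_linear manin_runit_invM erefl.

End BraidUnit.

Lemma manin_assocE A B C k (a : A k) (b : B k) (c : C k) :
  manin_assoc A B C k (a ⊗ b ⊗ c) = a ⊗ (b ⊗ c).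
Proof. exact: (tassocE a b c). Qed.

Lemma manin_assoc_invE A B C k (a : A k) (b : B k) (c : C k) :
  manin_assoc_inv A B C k (a ⊗ (b ⊗ c)) = a ⊗ b ⊗ c.
Proof. exact: (tassoc_invE a b c). Qed.

Lemma manin_braidE A B k (a : A k) (b : B k) : manin_braid A B k (a ⊗ b) = b ⊗ a.
Proof. exact: (tswapE a b). Qed.

Lemma manin_lunitE A k (c : K^o) (a : A k) : manin_lunit A k (c ⊗ a) = c *: a.
Proof. exact: (tscalelE c a). Qed.

Lemma manin_runitE A k (c : K^o) (a : A k) : manin_runit A k (a ⊗ c) = c *: a.
Proof. exact: (tscalerE c a). Qed.

Lemma manin_hom3lP A B C D (f g : grhom (manin (manin A B) C) D) :
  (forall k (a : A k) (b : B k) (c : C k), f k (a ⊗ b ⊗ c) = g k (a ⊗ b ⊗ c)) ->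
  f = g.
Proof.
move=> fg; apply: manin_homP => k x c; elim/tens_ind: x => [//|x y IHx IHy].
by rewrite !tpureDl !grfunD IHx IHy.
Qed.

Lemma manin_hom3rP A B C D (f g : grhom (manin A (manin B C)) D) :
  (forall k (a : A k) (b : B k) (c : C k), f k (a ⊗ (b ⊗ c)) = g k (a ⊗ (b ⊗ c))) ->
  f = g.
Proof.
move=> fg; apply: manin_homP => k a x; elim/tens_ind: x => [//|x y IHx IHy].
by rewrite !tpureDr !grfunD IHx IHy.
Qed.

Lemma manin_hom4P A B C D E (f g : grhom (manin (manin (manin A B) C) D) E) :
  (forall k (a : A k) (b : B k) (c : C k) (d : D k),
    f k (a ⊗ b ⊗ c ⊗ d) = g k (a ⊗ b ⊗ c ⊗ d)) ->
  f = g.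
Proof.
move=> fg; apply: manin_hom3lP => k x c d; elim/tens_ind: x => [//|x y IHx IHy].
by rewrite !tpureDl !grfunD IHx IHy.
Qed.

Lemma grcomposeE A B C (g : grhom B C) (f : grhom A B) k (x : A k) :
  grcompose g f k x = g k (f k x).
Proof. by []. Qed.

Let maninsE := (grcomposeE, manin_mapE, manin_assocE, manin_assoc_invE,
  manin_braidE, manin_lunitE, manin_runitE).

Lemma manin_map_id A B : manin_map (grid A) (grid B) = grid (manin A B).
Proof. by apply: manin_homP => k a b; rewrite manin_mapE. Qed.

Lemma manin_map_comp A A' A'' B B' B'' (f' : grhom A' A'') (f : grhom A A')
    (g' : grhom B' B'') (g : grhom B B') :
  manin_map (grcompose f' f) (grcompose g' g)
  = grcompose (manin_map f' g') (manin_map f g).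
Proof. by apply: manin_homP => k a b; rewrite !maninsE. Qed.

Lemma manin_assoc_iso A B C :
  inverse_pair (C := GrAlgCat K) (manin_assoc A B C) (manin_assoc_inv A B C).
Proof.
split; first by apply: manin_hom3lP => k a b c; rewrite !maninsE.
by apply: manin_hom3rP => k a b c; rewrite !maninsE.
Qed.

Lemma manin_assoc_natural A A' B B' C C'
    (f : grhom A A') (g : grhom B B') (h : grhom C C') :
  grcompose (manin_assoc A' B' C') (manin_map (manin_map f g) h)
  = grcompose (manin_map f (manin_map g h)) (manin_assoc A B C).
Proof. by apply: manin_hom3lP => k a b c; rewrite !maninsE. Qed.

Lemma manin_lunit_iso A :
  inverse_pair (C := GrAlgCat K) (manin_lunit A) (manin_lunit_inv A).
Proof.
split; last first.
  by apply: grhomP => k a; apply: etrans (manin_lunitE _ _) (scale1r a).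
apply: manin_homP => k c a.
transitivity (manin_lunit_inv A k (c *: a)); first by rewrite -manin_lunitE.
rewrite /= /manin_lunit_inv_fun.
by rewrite tpureZr -tpureZl /GRing.scale /= mulr1.
Qed.

Lemma manin_lunit_natural A A' (f : grhom A A') :
  grcompose (manin_lunit A') (manin_map (grid (manin_unit K)) f)
  = grcompose f (manin_lunit A).
Proof.
apply: manin_homP => k c a.
by rewrite !maninsE (linZ (grfun_linear f (k := k))).
Qed.

Lemma manin_runit_iso A :
  inverse_pair (C := GrAlgCat K) (manin_runit A) (manin_runit_inv A).
Proof.
split; last first.
  by apply: grhomP => k a; apply: etrans (manin_runitE _ _) (scale1r a).
apply: manin_homP => k a c.
transitivity (manin_runit_inv A k (c *: a)); first by rewrite -manin_runitE.
rewrite /= /manin_runit_inv_fun.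
by rewrite tpureZl -tpureZr /GRing.scale /= mulr1.
Qed.

Lemma manin_runit_natural A A' (f : grhom A A') :
  grcompose (manin_runit A') (manin_map f (grid (manin_unit K)))
  = grcompose f (manin_runit A).
Proof.
apply: manin_homP => k a c.
by rewrite !maninsE (linZ (grfun_linear f (k := k))).
Qed.

Lemma manin_braid_natural A A' B B' (f : grhom A A') (g : grhom B B') :
  grcompose (manin_braid A' B') (manin_map f g)
  = grcompose (manin_map g f) (manin_braid A B).
Proof. by apply: manin_homP => k a b; rewrite !maninsE. Qed.

Lemma manin_braid_sym A B :
  grcompose (manin_braid B A) (manin_braid A B) = grid (manin A B).
Proof. by apply: manin_homP => k a b; rewrite !maninsE. Qed.

Lemma manin_pentagon A B C D :
  grcompose (manin_assoc A B (manin C D)) (manin_assoc (manin A B) C D)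
  = grcompose
      (grcompose (manin_map (grid A) (manin_assoc B C D))
        (manin_assoc A (manin B C) D))
      (manin_map (manin_assoc A B C) (grid D)).
Proof. by apply: manin_hom4P => k a b c d; rewrite !maninsE. Qed.

Lemma manin_triangle A B :
  grcompose (manin_map (grid A) (manin_lunit B)) (manin_assoc A (manin_unit K) B)
  = manin_map (manin_runit A) (grid B).
Proof.
by apply: manin_hom3lP => k a c b; rewrite !maninsE tpureZl tpureZr.
Qed.

Lemma manin_hexagon A B C :
  grcompose
    (grcompose (manin_assoc B C A) (manin_braid A (manin B C)))
    (manin_assoc A B C)
  = grcompose
      (grcompose (manin_map (grid B) (manin_braid A C)) (manin_assoc B A C))
      (manin_map (manin_braid A B) (grid C)).
Proof. by apply: manin_hom3lP => k a b c; rewrite !maninsE. Qed.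

Definition ManinSMC : symmetric_monoidal_category :=
  {| smc_cat := GrAlgCat K;
     tob := @manin K;
     tmor := @manin_map K;
     tmor_id := manin_map_id;
     tmor_comp := manin_map_comp;
     tunit := manin_unit K;
     assoc := manin_assoc;
     assoc_inv := manin_assoc_inv;
     assoc_iso := manin_assoc_iso;
     assoc_natural := manin_assoc_natural;
     lunit := manin_lunit;
     lunit_inv := manin_lunit_inv;
     lunit_iso := manin_lunit_iso;
     lunit_natural := manin_lunit_natural;
     runit := manin_runit;
     runit_inv := manin_runit_inv;
     runit_iso := manin_runit_iso;
     runit_natural := manin_runit_natural;
     braid := manin_braid;
     braid_natural := manin_braid_natural;
     braid_sym := manin_braid_sym;
     pentagon := manin_pentagon;
     triangle := manin_triangle;
     hexagon := manin_hexagon |}.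

End ManinSMC.

Section GradedQuotient.
Variables (K : fieldType) (A : gralg K) (S : forall k, A k -> Prop).

(* The homogeneous components of the two-sided ideal generated by the
   homogeneous elements satisfying [S]. *)
Inductive in_ideal : forall k, A k -> Prop :=
| in_ideal_gen k (x : A k) : S x -> in_ideal x
| in_ideal0 k : in_ideal (0 : A k)
| in_ideal_lin k c (x y : A k) :
    in_ideal x -> in_ideal y -> in_ideal (c *: x + y)
| in_idealMl k l m (e : k + l = m) (a : A k) (x : A l) :
    in_ideal x -> in_ideal (gmul e a x)
| in_idealMr k l m (e : k + l = m) (x : A k) (a : A l) :
    in_ideal x -> in_ideal (gmul e x a).

Section Component.
Variable k : int.

Definition ideal_mem : A k -> bool := fun x => `[< in_ideal x >].

Lemma ideal_closed : submod_closed ideal_mem.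
Proof.
split; first by apply/asboolP; apply: in_ideal0.
by move=> c x y /asboolP hx /asboolP hy; apply/asboolP; apply: in_ideal_lin.
Qed.

HB.instance Definition _ := GRing.isSubmodClosed.Build K (A k) ideal_mem ideal_closed.

Definition ideal : submodClosed (A k) := GRing.SubmodClosed.clone K (A k) ideal_mem _.

Lemma idealP x : x \in ideal <-> in_ideal x.
Proof. by split=> [/asboolP|h] //; apply/asboolP. Qed.

End Component.

Definition grquot_comp (k : int) : lmodType K := quotmod (ideal k).

Definition grquot_mul k l m (e : k + l = m) (x : grquot_comp k)
    (y : grquot_comp l) : grquot_comp m :=
  quot_pi _ (gmul e (quot_repr _ x) (quot_repr _ y)).

Lemma grquot_mulE k l m (e : k + l = m) (a : A k) (b : A l) :
  grquot_mul e (quot_pi _ a) (quot_pi _ b) = quot_pi _ (gmul e a b).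
Proof.
have rep n (x : A n) : in_ideal (quot_repr _ (quot_pi (ideal n) x) - x).
  by apply/idealP; apply/quot_piE; rewrite quot_reprK.
apply/quot_piE; apply/idealP; set a' := quot_repr _ _; set b' := quot_repr _ _.
have -> : gmul e a' b' - gmul e a b = 1 *: gmul e (a' - a) b' + gmul e a (b' - b).
  rewrite scale1r gmulDl gmulDr -(scaleN1r a) -(scaleN1r b) gmulZl gmulZr.
  by rewrite !scaleN1r addrA subrK.
by apply: in_ideal_lin; [apply: in_idealMr | apply: in_idealMl]; apply: rep.
Qed.

Lemma grquot_mul_bilin k l m (e : k + l = m) : bilin (grquot_mul e).
Proof.
split=> [y|x] c u v; rewrite -[u]quot_reprK -[v]quot_reprK -quot_pi_linear.
  by rewrite -[y]quot_reprK !grquot_mulE -quot_pi_linear !gmulE.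
by rewrite -[x]quot_reprK !grquot_mulE -quot_pi_linear !gmulE.
Qed.

Lemma grquot_mulA k l m kl lm klm (e1 : k + l = kl) (e2 : kl + m = klm)
    (e3 : l + m = lm) (e4 : k + lm = klm) x y z :
  grquot_mul e2 (grquot_mul e1 x y) z = grquot_mul e4 x (grquot_mul e3 y z).
Proof.
rewrite -[x]quot_reprK -[y]quot_reprK -[z]quot_reprK !grquot_mulE.
by rewrite (gmulA e1 e2 e3 e4).
Qed.

Definition grquot_one : grquot_comp 0 := quot_pi _ gone.

Lemma grquot_mul1l k (e : 0 + k = k) x : grquot_mul e grquot_one x = x.
Proof. by rewrite -[x]quot_reprK grquot_mulE gmul1l. Qed.

Lemma grquot_mul1r k (e : k + 0 = k) x : grquot_mul e x grquot_one = x.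
Proof. by rewrite -[x]quot_reprK grquot_mulE gmul1r. Qed.

Definition grquot : gralg K :=
  GrAlg grquot_mul_bilin grquot_mulA grquot_mul1l grquot_mul1r.

End GradedQuotient.

Section TensorAlgebra.
Variables (K : fieldType) (W : lmodType K).

(* The right-nested tensor power, so that degree 1 is [tens W K^o]. *)
Fixpoint tpow (n : nat) : lmodType K :=
  if n is n'.+1 then tens W (tpow n') else K^o.

Fixpoint tpow_mul (p q : nat) : tpow p -> tpow q -> tpow (p + q) :=
  match p with
  | 0 => fun (a : K^o) y => a *: y
  | p'.+1 => fun x y => tens_lift (fun w x' => w ⊗ tpow_mul x' y) x
  end.

Definition tpow_cast (m n : nat) (e : m = n) (x : tpow m) : tpow n :=
  ecast i (tpow i) e x.

Lemma tpow_mul_bilin p q : bilin (@tpow_mul p q).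
Proof.
elim: p => [|p [IHl IHr]].
  split=> [y|a] c u v /=; first by rewrite scalerDl scalerA.
  by rewrite scalerDr !scalerA mulrC.
have L c u v (y : tpow q) : tpow_mul (c *: u + v : tpow p) y = c *: tpow_mul u y + tpow_mul v y.
  exact: (IHl y c u v).
have B (y : tpow q) : bilin (fun w (x' : tpow p) => (w : W) ⊗ tpow_mul x' y).
  by split=> [x|w] c u v; rewrite ?L !tpureE.
split=> [y|x]; first exact: tens_lift_linear (B y).
apply: (tens_lift_param (F := fun z w x' => w ⊗ tpow_mul x' z)); first exact: B.
by move=> w x' c u v; rewrite (IHr x') !tpureE.
Qed.

Lemma tpow_mulS p q w (x : tpow p) (y : tpow q) :
  tpow_mul (w ⊗ x : tpow p.+1) y = w ⊗ tpow_mul x y.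
Proof.
apply: (tens_liftE (f := fun w x' => w ⊗ tpow_mul x' y)).
have L c u v : tpow_mul (c *: u + v : tpow p) y = c *: tpow_mul u y + tpow_mul v y.
  exact: ((tpow_mul_bilin p q).1 y c u v).
by split=> [x'|w'] c u v; rewrite ?L !tpureE.
Qed.

Lemma tpow_castE n (e : n = n) x : tpow_cast e x = x.
Proof. by rewrite eq_axiomK. Qed.

Lemma tpow_castS m n (e : m = n) (e' : m.+1 = n.+1) w (x : tpow m) :
  tpow_cast e' (w ⊗ x : tpow m.+1) = w ⊗ tpow_cast e x.
Proof. by case: _ / e in e' *; rewrite !tpow_castE. Qed.

Lemma tpow_castD m n (e : m = n) x y :
  tpow_cast e (x + y) = tpow_cast e x + tpow_cast e y.
Proof. by case: _ / e. Qed.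

Lemma tpow_mulDl p q (x x' : tpow p) (y : tpow q) :
  tpow_mul (x + x') y = tpow_mul x y + tpow_mul x' y.
Proof. exact: linD ((tpow_mul_bilin p q).1 y) x x'. Qed.

Lemma tpow_mulA p q r (e : (p + q + r = p + (q + r))%N) x y z :
  tpow_cast e (tpow_mul (tpow_mul x y) z) = tpow_mul x (@tpow_mul q r y z).
Proof.
elim: p e x => [|p IHp] e x.
  by rewrite tpow_castE /= (linZ ((tpow_mul_bilin q r).1 z)).
have e' : (p + q + r = p + (q + r))%N by rewrite addnA.
elim/tens_ind: x => [w x|x x' IHx IHx'].
  by rewrite !tpow_mulS -(IHp e') -tpow_castS.
by rewrite [tpow_mul _ y]tpow_mulDl !tpow_mulDl tpow_castD IHx IHx'.
Qed.

Lemma tpow_mul1r p (e : (p + 0 = p)%N) (x : tpow p) :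
  tpow_cast e (tpow_mul x (1 : tpow 0)) = x.
Proof.
elim: p e x => [|p IHp] e x; first by rewrite tpow_castE; apply: (mulr1 (x : K)).
have e' : (p + 0 = p)%N by rewrite addn0.
elim/tens_ind: x => [w x|x x' IHx IHx'].
  by rewrite tpow_mulS -[in RHS](IHp e' x) -tpow_castS.
by rewrite tpow_mulDl tpow_castD IHx IHx'.
Qed.

(* The tensor algebra of [W], with [W] in degree 1: its components of negative
   degree are the zero space. *)
Definition tensalg_comp (k : int) : lmodType K :=
  match k with Posz n => tpow n | Negz _ => 'rV[K]_0 end.

Definition tensalg_mul (k l m : int) : k + l = m ->
    tensalg_comp k -> tensalg_comp l -> tensalg_comp m :=
  match k, l, m with
  | Posz p, Posz q, Posz r => fun (e : Posz (p + q) = Posz r) x y =>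
      tpow_cast (congr1 absz e) (tpow_mul x y)
  | _, _, _ => fun _ _ _ => 0
  end.
Arguments tensalg_mul {k l m} e x y.

Lemma tensalg_mul_bilin k l m (e : k + l = m) : bilin (tensalg_mul e).
Proof.
case: k l m e => [p|p] [q|q] [r|r] e;
  try by split=> [y|x] c u v; rewrite /= scaler0 addr0.
rewrite /tensalg_mul; move: (congr1 absz e) => /= {}e; case: _ / e.
exact: tpow_mul_bilin.
Qed.

Lemma tensalg_mulA k l m kl lm klm (e1 : k + l = kl) (e2 : kl + m = klm)
    (e3 : l + m = lm) (e4 : k + lm = klm) x y z :
  tensalg_mul e2 (tensalg_mul e1 x y) z = tensalg_mul e4 x (tensalg_mul e3 y z).
Proof.
have mul0l k' l' m' (e : k' + l' = m') y' : tensalg_mul e 0 y' = 0.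
  exact: lin0 ((tensalg_mul_bilin e).1 y').
have mul0r k' l' m' (e : k' + l' = m') x' : tensalg_mul e x' 0 = 0.
  exact: lin0 ((tensalg_mul_bilin e).2 x').
case: k e1 e4 x => p e1 e4 x; last first.
  by rewrite (_ : tensalg_mul e1 x y = 0) // mul0l.
case: l e1 e3 y => q e1 e3 y; last first.
  rewrite (_ : tensalg_mul e1 x y = 0) // mul0l.
  by rewrite (_ : tensalg_mul e3 y z = 0) // mul0r.
case: m e2 e3 z => r e2 e3 z; last first.
  rewrite (_ : tensalg_mul e3 y z = 0) // mul0r.
  by case: kl e1 e2 => kl e1 e2.
case: kl e1 e2 => // pq e1 e2; case: lm e3 e4 => // qr e3 e4.
case: klm e2 e4 => // s e2 e4.
rewrite /tensalg_mul.
move: (congr1 absz e1) (congr1 absz e2) (congr1 absz e3) (congr1 absz e4) => /= f1 f2 f3 f4.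
subst pq qr; case: s / f4 f2 {e1 e2 e3 e4} => f2.
by rewrite !tpow_castE; apply: tpow_mulA.
Qed.

Definition tensalg_one : tensalg_comp 0 := (1 : K^o).

Lemma tensalg_mul1l k (e : 0 + k = k) x : tensalg_mul e tensalg_one x = x.
Proof.
case: k e x => [p|p] e x; last by rewrite /= [x]thinmx0.
by rewrite /= tpow_castE /tensalg_one scale1r.
Qed.

Lemma tensalg_mul1r k (e : k + 0 = k) x : tensalg_mul e x tensalg_one = x.
Proof.
case: k e x => [p|p] e x; last by rewrite /= [x]thinmx0.
exact: tpow_mul1r.
Qed.

Definition tensalg : gralg K :=
  GrAlg tensalg_mul_bilin tensalg_mulA tensalg_mul1l tensalg_mul1r.

Definition tens_deg2 (t : tens W W) : tensalg 2 :=
  tens_lift (fun w w' => (w ⊗ (w' ⊗ (1 : K^o)) : tpow 2)) t.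

Inductive quad_rel (S : submodClosed (tens W W)) :
    forall k, tensalg k -> Prop :=
| QuadRel t : t \in S -> quad_rel S (tens_deg2 t).

Definition quadalg (S : submodClosed (tens W W)) : gralg K :=
  grquot (@quad_rel S).

End TensorAlgebra.

Definition FQA (K : fieldType) (A : gralg K) : Prop :=
  exists (W : vectType K) (S : submodClosed (tens W W)),
    isomorphic (C := GrAlgCat K) A (quadalg S).

(* Main.v *)
From mathcomp Require Import all_boot all_algebra.
From mathcomp Require Import boolp.
Require Import Defs.

(** A relative left adjoint exists as soon as every object of the subcategory
    has a universal arrow to the functor: choosing one for each object gives the
    functor and the bijections ([relative_adjoint_of_universal]).  So it suffices
    to find, for [A = TW/(S)] and [B] quadratic, a universal arrow from [A] to
    [- ∘ B].

    All components of [B] are finite-dimensional.  Let [e_1, ..., e_n] be a basis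
    of [B_1] with coordinate functionals [eps_i].  A morphism from the tensor
    algebra [TW] to [Z ∘ B] is a linear map from [W] to [Z_1 ⊗ B_1]; taking
    coordinates, it is a family of [n] linear maps from [W] to [Z_1], that is, a
    linear map from [W^n] (a model of [W ⊗ B_1^*]) to [Z_1], that is, a morphism
    from [T(W^n)] to [Z].  Under this correspondence the identity of [T(W^n)]
    gives the coaction [coact_free] from [TW] to [T(W^n) ∘ B], which sends a
    generator [w] to the sum of the [w_i ⊗ e_i], where [w_i] is [w] placed in the
    [i]-th copy of [W].

    The morphism out of [TW] attached to [f : T(W^n) -> Z] kills [s] in [S] iff
    [(f ⊗ id)(coact_free s) = 0] in [Z_k ⊗ B_k].  As [B_k] is finite-dimensional,
    linear functionals on [B_k] separate the points of [Z_k ⊗ B_k]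
    ([tcontract_inj]), so this holds iff [f] kills all the contractions
    [(id ⊗ xi)(coact_free s)].  Dividing [T(W^n)] by these contractions yields the
    algebra [cohom], and the coaction descends to the universal arrow
    ([coact_universal]).  The relations of [A] may be arbitrary homogeneous ones,
    and of [B] only the finite dimension of its components matters. *)

Set Implicit Arguments.
Unset Strict Implicit.
Unset Printing Implicit Defensive.

Import GRing.Theory.

Local Open Scope ring_scope.
Local Open Scope cat_scope.

(** * Universal arrows *)

(** [u] is initial among the arrows from [X] to the functor [G]. *)
Definition universal_arrow (C D : category) (G : functor D C) (X : C) (Y : D)
    (u : hom X (G Y)) : Prop :=
  forall (Z : D) (h : hom X (G Z)),
    exists2 g : hom Y Z, fmor G g \c u = h &
      forall g' : hom Y Z, fmor G g' \c u = h -> g' = g.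

Definition has_universal_arrow (C D : category) (G : functor D C) (X : C) : Prop :=
  exists (Y : D) (u : hom X (G Y)), universal_arrow u.

(** Having a universal arrow is invariant under isomorphism of the source. *)
Lemma has_universal_arrow_iso (C D : category) (G : functor D C) (X X' : C) :
  isomorphic X X' -> has_universal_arrow G X' -> has_universal_arrow G X.
Proof.
move=> [f [f' [f'f ff']]] [Y [u uP]]; exists Y, (u \c f) => Z h.
have [g gu gP] := uP Z (h \c f').
exists g; first by rewrite compA gu -compA f'f comp_idr.
by move=> g' g'u; apply: gP; rewrite -g'u -!compA ff' comp_idr.
Qed.

Section AdjointFromUniversal.
Variables (C D : category) (G : functor D C) (P : C -> Prop).
Hypothesis univ : forall X, P X -> has_universal_arrow G X.

Let C' := full_subcategory P.

Let Fobj (X : C') : D := sval (cid (univ (svalP X))).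

Let unit_sig (X : C') : {u : hom (sval X) (G (Fobj X)) | universal_arrow u} :=
  cid (svalP (cid (univ (svalP X)))).

Let unit (X : C') : hom (sval X) (G (Fobj X)) := sval (unit_sig X).

Let unitP X : universal_arrow (unit X).
Proof. exact: svalP (unit_sig X). Qed.

(* The transpose of [h]: the arrow through which [h] factors. *)
Let desc (X : C') (Z : D) (h : hom (sval X) (G Z)) : hom (Fobj X) Z :=
  s2val (cid2 (unitP h)).

Let descK X Z (h : hom (sval X) (G Z)) : fmor G (desc h) \c unit X = h.
Proof. exact: s2valP (cid2 (unitP h)). Qed.

Let desc_unique X Z (g : hom (Fobj X) Z) : desc (fmor G g \c unit X) = g.
Proof. by apply: esym; apply: (s2valP' (cid2 (unitP (fmor G g \c unit X)))). Qed.

Let Fmor (X Y : C') (f : hom X Y) : hom (Fobj X) (Fobj Y) :=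
  desc (unit Y \c (f : hom (sval X) (sval Y))).

Let Fmor_id X : Fmor (idm X) = idm (Fobj X).
Proof. by rewrite -[RHS]desc_unique fmor_id comp_idl /Fmor /= comp_idr. Qed.

Let Fmor_comp (X Y Z : C') (g : hom Y Z) (f : hom X Y) :
  Fmor (g \c f) = Fmor g \c Fmor f.
Proof.
by rewrite -[RHS]desc_unique fmor_comp -compA descK compA descK -compA.
Qed.

Lemma relative_adjoint_of_universal : inhabited (relative_left_adjoint G P).
Proof.
constructor.
pose F := Functor Fmor_id Fmor_comp.
pose phi (X : C') (Z : D) (g : hom (F X) Z) : hom (sval X) (G Z) :=
  fmor G g \c unit X.
apply: (@RelativeLeftAdjoint C D G P F phi).
  by move=> X Z; exists (@desc X Z) => x; [apply: desc_unique|apply: descK].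
move=> X X' Z Z' f g h; rewrite /phi /F /=.
by rewrite !fmor_comp -!compA descK.
Qed.

End AdjointFromUniversal.

(** * Finite-dimensional spaces *)

Section FiniteDimension.
Variable K : fieldType.

(** [V] is spanned by [n] vectors, which need not be independent. *)
Definition fin_spanned (V : lmodType K) (n : nat) : Prop :=
  exists e : 'I_n -> V, forall v, exists c : 'I_n -> K, v = \sum_i c i *: e i.

Definition fin_dim (V : lmodType K) : Prop := exists n, fin_spanned V n.

(** [e] is a basis of [V], with dual family of coordinate functionals [xi].
    The last condition expresses the independence of [e]. *)
Definition is_basis (V : lmodType K) (n : nat) (e : 'I_n -> V)
    (xi : 'I_n -> V -> K^o) : Prop :=
  [/\ forall i, linear (xi i), forall v, v = \sum_i xi i v *: e i
    & forall i j, xi i (e j) = (i == j)%:R].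

(** A spanning family of minimal size is a basis. *)
Lemma fin_dim_basis (V : lmodType K) :
  fin_dim V -> exists n (e : 'I_n -> V) (xi : 'I_n -> V -> K^o), is_basis e xi.
Proof.
move=> fV.
have exn : exists n, `[< fin_spanned V n >] by case: fV => n h; exists n; apply/asboolP.
case: (ex_minnP exn) => n /asboolP[e eP] nmin.
have free (c : 'I_n -> K) : \sum_i c i *: e i = 0 -> forall i, c i = 0.
  (* A nonzero [c j] would make [e j] redundant, against minimality. *)
  move=> c0 j; apply/eqP/negP => /negP cj.
  case: n e eP nmin c j c0 cj => [|n] e eP nmin c j c0 cj; first by case: j cj.
  suff /asboolP/nmin : fin_spanned V n by rewrite ltnn.
  exists (fun i => e (lift j i)) => v; have [d dv] := eP v.
  exists (fun i => d (lift j i) - d j / c j * c (lift j i)).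
  have -> : v = \sum_i (d i - d j / c j * c i) *: e i.
    under eq_bigr do rewrite scalerBl -scalerA.
    by rewrite sumrB -scaler_sumr c0 scaler0 subr0.
  by rewrite (bigD1_ord j) //= divfK // subrr scale0r add0r.
pose xi i v : K^o := sval (cid (eP v)) i.
have xiP v : v = \sum_i xi i v *: e i by exact: svalP (cid (eP v)).
have uniq (c d : 'I_n -> K) : \sum_i c i *: e i = \sum_i d i *: e i -> c =1 d.
  move=> cd i; apply/eqP; rewrite -subr_eq0; apply/eqP.
  apply: (free (fun i => c i - d i)).
  by under eq_bigr do rewrite scalerBl; rewrite sumrB cd subrr.
exists n, e, xi; split => // [i a u v|i j].
  apply: (uniq (xi^~ (a *: u + v)) (fun i => a * xi i u + xi i v)).
  rewrite -xiP; under eq_bigr do rewrite scalerDl -scalerA.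
  by rewrite big_split /= -scaler_sumr -!xiP.
apply: (uniq (xi^~ (e j)) (fun i => (i == j)%:R)).
rewrite -xiP (bigD1 j) //= eqxx scale1r big1 ?addr0 // => k /negPf ->.
by rewrite scale0r.
Qed.

Lemma fin_dim_gen (V : lmodType K) (I : finType) (e : I -> V) :
  (forall v, exists c : I -> K, v = \sum_i c i *: e i) -> fin_dim V.
Proof.
move=> eP; exists #|I|, (fun i => e (enum_val i)) => v; have [c ->] := eP v.
exists (fun i => c (enum_val i)).
by rewrite (reindex (@enum_val I predT)) //; apply: onW_bij; apply: enum_val_bij.
Qed.

Lemma fin_dim_surj (U V : lmodType K) (f : U -> V) :
  linear f -> (forall v, exists u, f u = v) -> fin_dim U -> fin_dim V.
Proof.
move=> lf sf [n [e eP]]; exists n, (f \o e) => v.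
have [u <-] := sf v; have [c ->] := eP u; exists c.
rewrite (big_morph f (linD lf) (lin0 lf)).
by apply: eq_bigr => i _; rewrite (linZ lf).
Qed.

Lemma fin_dim_quot (V : lmodType K) (I : submodClosed V) :
  fin_dim V -> fin_dim (quotmod I).
Proof.
apply: (fin_dim_surj (quot_pi_linear I)) => v.
by exists (quot_repr I v); apply: quot_reprK.
Qed.

Lemma fin_dim_tens (U V : lmodType K) :
  fin_dim U -> fin_dim V -> fin_dim (tens U V).
Proof.
move=> [m [e eP]] [n [f fP]].
apply: (@fin_dim_gen _ _ (fun p : 'I_m * 'I_n => e p.1 ⊗ f p.2)) => x.
elim/tens_ind: x => [u v|x y [c ->] [d ->]].
  have [c ->] := eP u; have [d ->] := fP v.
  exists (fun p => c p.1 * d p.2).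
  have [lL lR] := tpure_bilin U V.
  rewrite (big_morph _ (linD (lL _)) (lin0 (lL _))).
  rewrite -(pair_bigA _ (fun i j => (c i * d j) *: (e i ⊗ f j))) /=.
  apply: eq_bigr => i _.
  rewrite (big_morph _ (linD (lR _)) (lin0 (lR _))).
  by apply: eq_bigr => j _; rewrite tpureZl tpureZr scalerA.
exists (fun p => c p + d p).
by under [RHS]eq_bigr do rewrite scalerDl; rewrite big_split.
Qed.

Lemma fin_dim_vect (V : vectType K) : fin_dim V.
Proof.
exists (\dim {:V}), (fun i => (vbasis {:V})`_i) => v.
by exists (fun i => coord (vbasis {:V}) i v); apply: coord_vbasis; apply: memvf.
Qed.

Lemma fin_dim_tpow (V : vectType K) n : fin_dim (tpow V n).
Proof.
elim: n => [|n IH]; last exact: fin_dim_tens (fin_dim_vect V) IH.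
exact: (fin_dim_vect K^o).
Qed.

Lemma fin_dim_quadalg (V : vectType K) (S : submodClosed (tens V V)) k :
  fin_dim (quadalg S k).
Proof.
apply: fin_dim_quot; case: k => n; first exact: fin_dim_tpow.
exact: (fin_dim_vect 'rV[K]_0).
Qed.

End FiniteDimension.

(** * Morphisms out of tensor algebras and quotients *)

Lemma gmul_comp_bilin (K : fieldType) (Z : gralg K) (U V : lmodType K)
    k l m (e : k + l = m) (f : U -> Z k) (g : V -> Z l) :
  linear f -> linear g -> bilin (fun u v => gmul e (f u) (g v)).
Proof.
by move=> lf lg; split=> [v|u] a x y; rewrite ?lf ?lg !gmulE.
Qed.

Section TensorAlgebraLift.
Variables (K : fieldType) (W : lmodType K).

(** The inclusion of [W] as the degree 1 component of its tensor algebra, which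
    is [tens W K^o]. *)
Definition tensalg_gen (w : W) : tensalg W 1 := w ⊗ (1 : K^o).

Lemma tensalg_gen_linear : linear tensalg_gen.
Proof. by move=> a u v; rewrite /tensalg_gen !tpureE. Qed.

Lemma tensalg_cons n (e : 1 + n%:Z = n.+1%:Z) (w : W) (x : tpow W n) :
  (w ⊗ x : tensalg W n.+1) = gmul e (tensalg_gen w) (x : tensalg W n).
Proof.
rewrite /= tpow_castE.
transitivity (w ⊗ tpow_mul (1 : tpow W 0) x); first by rewrite /= scale1r.
exact: esym (tpow_mulS (p := 0) w (1 : K^o) x).
Qed.

(** [tensalg W] is generated by [W] in degree 1. *)
Lemma tensalg_homP (Z : gralg K) (f g : grhom (tensalg W) Z) :
  (forall w, f 1 (tensalg_gen w) = g 1 (tensalg_gen w)) -> f = g.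
Proof.
move=> fg; apply: grhomP => -[n|n] x; last first.
  (* Components of negative degree vanish. *)
  rewrite (_ : x = 0) ?(lin0 (grfun_linear f (k := _)))
    ?(lin0 (grfun_linear g (k := _))) //.
  exact: thinmx0.
elim: n x => [|n IH] x.
  have -> : x = (x : K) *: (gone : tensalg W 0) by rewrite /GRing.scale /= mulr1.
  rewrite (linZ (grfun_linear f (k := _))) (linZ (grfun_linear g (k := _))).
  by rewrite !grfun1.
elim/tens_ind: x => [w x|x y IHx IHy]; last first.
  by have := @grfunD _ _ _ f n.+1 x y; have := @grfunD _ _ _ g n.+1 x y;
    rewrite /= IHx IHy => -> ->.
by rewrite (tensalg_cons (esym (intS n))) !grfunM fg IH.
Qed.

Variables (Z : gralg K) (psi : W -> Z 1).
Hypothesis psi_linear : linear psi.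

(** [tpow_lift] sends [w_1 ⊗ ... ⊗ w_n] to the product of the [psi w_i]; it is
    the degree [n] part of the morphism extending [psi]. *)
Fixpoint tpow_lift (n : nat) : tpow W n -> Z n :=
  match n return tpow W n -> Z n with
  | 0 => fun a : K^o => a *: (gone : Z 0)
  | n'.+1 => fun x : tens W (tpow W n') =>
      tens_lift (fun w y => gmul (esym (intS n')) (psi w) (tpow_lift y)) x
  end.

Lemma tpow_lift_linear n : linear (@tpow_lift n).
Proof.
elim: n => [|n IH]; first by move=> a u v /=; rewrite scalerDl scalerA.
exact: tens_lift_linear (gmul_comp_bilin _ psi_linear IH).
Qed.

Lemma tpow_liftS n w (x : tpow W n) :
  tpow_lift (w ⊗ x : tpow W n.+1) = gmul (esym (intS n)) (psi w) (tpow_lift x).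
Proof.
exact: tens_liftE (gmul_comp_bilin _ psi_linear (tpow_lift_linear (n := n))) w x.
Qed.

Lemma tpow_liftM p q (e : p%:Z + q%:Z = (p + q)%N%:Z) (x : tpow W p) (y : tpow W q) :
  tpow_lift (tpow_mul x y) = gmul e (tpow_lift x) (tpow_lift y).
Proof.
elim: p e x => [|p IH] e x.
  by rewrite /= (linZ (tpow_lift_linear (n := q))) gmulZl gmul1l.
elim/tens_ind: x => [w x|x x' IHx IHx']; last first.
  rewrite tpow_mulDl (linD (tpow_lift_linear (n := (p.+1 + q)%N))) IHx IHx'.
  by rewrite (linD (tpow_lift_linear (n := p.+1)) x) gmulDl.
rewrite tpow_mulS (tpow_liftS (n := (p + q)%N)) (IH (erefl _)) tpow_liftS.
by apply: esym; apply: gmulA.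
Qed.

Definition tensalg_lift_fun (k : int) : tensalg W k -> Z k :=
  match k with Posz n => @tpow_lift n | Negz _ => fun=> 0 end.

Lemma tensalg_lift_linear k : linear (@tensalg_lift_fun k).
Proof.
case: k => n; first exact: tpow_lift_linear.
by move=> a u v; rewrite /= scaler0 addr0.
Qed.

Lemma tensalg_liftM k l m (e : k + l = m) x y :
  tensalg_lift_fun (gmul e x y) = gmul e (tensalg_lift_fun x) (tensalg_lift_fun y).
Proof.
have lf j := lin0 (tensalg_lift_linear (k := j)).
have mul0l k' l' m' (e' : k' + l' = m') (b : Z l') : gmul e' (0 : Z k') b = 0.
  exact: lin0 ((gmul_bilin e').1 b).
have mul0r k' l' m' (e' : k' + l' = m') (a : Z k') : gmul e' a (0 : Z l') = 0.
  exact: lin0 ((gmul_bilin e').2 a).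
case: k l m e x y => [p|p] [q|q] m e x y; first last.
- by rewrite [tensalg_lift_fun x]/= mul0l; apply: lf.
- by rewrite [tensalg_lift_fun x]/= mul0l; apply: lf.
- by rewrite [tensalg_lift_fun y]/= mul0r; apply: lf.
have e' : m = (p + q)%N%:Z by rewrite -e.
case: _ / (esym e') e => e; rewrite /= tpow_castE; exact: tpow_liftM.
Qed.

Lemma tensalg_lift1 : tensalg_lift_fun (gone : tensalg W 0) = gone.
Proof. by rewrite /= scale1r. Qed.

(** The graded algebra morphism from the tensor algebra extending [psi]. *)
Definition tensalg_lift : grhom (tensalg W) Z :=
  GrHom tensalg_lift_linear tensalg_liftM tensalg_lift1.

Lemma tensalg_liftE w : tensalg_lift 1 (tensalg_gen w) = psi w.
Proof.
rewrite /tensalg_gen [LHS](tpow_liftS (n := 0)) /= scale1r.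
exact: gmul1r.
Qed.

End TensorAlgebraLift.

Section QuotientLift.
Variables (K : fieldType) (A : gralg K) (S : forall k, A k -> Prop).

Definition grquot_pi_fun k : A k -> grquot S k := quot_pi (ideal S k).

Lemma grquot_pi_linear k : linear (@grquot_pi_fun k).
Proof. exact: quot_pi_linear. Qed.

Lemma grquot_piM k l m (e : k + l = m) a b :
  grquot_pi_fun (gmul e a b) = gmul e (grquot_pi_fun a) (grquot_pi_fun b).
Proof. by apply: esym; apply: grquot_mulE. Qed.

(** The projection of [A] onto its quotient by the ideal generated by [S]. *)
Definition grquot_pi : grhom A (grquot S) :=
  GrHom grquot_pi_linear grquot_piM erefl.

Lemma grquot_pi_rel k (s : A k) : S s -> grquot_pi k s = 0.
Proof.
move=> Ss; rewrite -(lin0 (@grquot_pi_linear k)); apply/quot_piE.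
by rewrite subr0; apply/idealP; apply: in_ideal_gen.
Qed.

Lemma grquot_homP (Z : gralg K) (f g : grhom (grquot S) Z) :
  grcompose f grquot_pi = grcompose g grquot_pi -> f = g.
Proof.
move=> fg; apply: grhomP => k x; rewrite -[x]quot_reprK.
exact: (congr1 (fun h : grhom A Z => h k (quot_repr _ x)) fg).
Qed.

Variables (Z : gralg K) (f : grhom A Z).
Hypothesis fS : forall k (s : A k), S s -> f k s = 0.

Lemma grhom_ideal0 k (x : A k) : in_ideal S x -> f k x = 0.
Proof.
elim=> {k x} [k s /fS //|k|k c x y _ IHx _ IHy|k l m e a x _ IH|k l m e x a _ IH].
- exact: lin0 (grfun_linear f (k := k)).
- by rewrite grfun_linear IHx IHy scaler0 addr0.
- by rewrite grfunM IH; apply: lin0 ((gmul_bilin e).2 _).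
- by rewrite grfunM IH; apply: lin0 ((gmul_bilin e).1 _).
Qed.

Definition grquot_lift_fun k (x : grquot S k) : Z k := f k (quot_repr _ x).

Lemma grquot_lift_funE k (a : A k) : grquot_lift_fun (grquot_pi k a) = f k a.
Proof.
have lf := grfun_linear f (k := k).
apply/eqP; rewrite -subr_eq0 -(linN lf) -(linD lf); apply/eqP.
by apply: grhom_ideal0; apply/idealP; apply/quot_piE; rewrite quot_reprK.
Qed.

Let pi_surj k (P : grquot S k -> Prop) : (forall a, P (grquot_pi k a)) -> forall x, P x.
Proof. by move=> Ppi x; rewrite -[x]quot_reprK; apply: Ppi. Qed.

Lemma grquot_lift_linear k : linear (@grquot_lift_fun k).
Proof.
move=> c; elim/pi_surj=> a; elim/pi_surj=> b.
by rewrite -(grfun_linear grquot_pi) !grquot_lift_funE grfun_linear.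
Qed.

Lemma grquot_liftM k l m (e : k + l = m) x y :
  grquot_lift_fun (gmul e x y) = gmul e (grquot_lift_fun x) (grquot_lift_fun y).
Proof.
elim/pi_surj: x => a; elim/pi_surj: y => b.
by rewrite -grfunM !grquot_lift_funE grfunM.
Qed.

Lemma grquot_lift1 : grquot_lift_fun gone = gone.
Proof. by rewrite -(grfun1 grquot_pi) grquot_lift_funE grfun1. Qed.

(** The morphism induced on the quotient by a morphism killing the relations. *)
Definition grquot_lift : grhom (grquot S) Z :=
  GrHom grquot_lift_linear grquot_liftM grquot_lift1.

Lemma grquot_liftE : grcompose grquot_lift grquot_pi = f.
Proof. by apply: grhomP => k a; apply: grquot_lift_funE. Qed.

End QuotientLift.

(** * Contraction against functionals *)

Section Contraction.
Variables (K : fieldType) (V : lmodType K).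

(** The map [id ⊗ xi] from [U ⊗ V] to [U], meaningful for linear [xi]. *)
Definition tcontract (U : lmodType K) (xi : V -> K^o) : tens U V -> U :=
  tens_lift (fun u v => (xi v : K) *: u).

Section Functional.
Variables (xi : V -> K^o) (xi_linear : linear xi).

Lemma tcontract_bilin (U : lmodType K) : bilin (fun (u : U) v => (xi v : K) *: u).
Proof.
split=> [v|u] a x y; first by rewrite scalerDr !scalerA mulrC.
by rewrite xi_linear scalerDl scalerA.
Qed.

Lemma tcontractE (U : lmodType K) (u : U) v : tcontract xi (u ⊗ v) = (xi v : K) *: u.
Proof. exact: tens_liftE (tcontract_bilin U) u v. Qed.

Lemma tcontract_linear (U : lmodType K) : linear (@tcontract U xi).
Proof. exact: tens_lift_linear (tcontract_bilin U). Qed.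

End Functional.

Lemma tcontract_expand (U : lmodType K) n (e : 'I_n -> V) xi (x : tens U V) :
  is_basis e xi -> x = \sum_i tcontract (xi i) x ⊗ e i.
Proof.
case=> lxi expand _; elim/tens_ind: x => [u v|x y IHx IHy].
  under eq_bigr do rewrite (tcontractE (lxi _)) tpureZl -tpureZr.
  have lR := (tpure_bilin U V).2 u.
  by rewrite -(big_morph _ (linD lR) (lin0 lR)) -expand.
under eq_bigr do rewrite (linD (tcontract_linear (lxi _) (U := U))) tpureDl.
by rewrite big_split /= -IHx -IHy.
Qed.

(** Functionals on a finite-dimensional [V] separate the points of [U ⊗ V]. *)
Lemma tcontract_inj (U : lmodType K) (x : tens U V) :
  fin_dim V -> (forall xi : V -> K^o, linear xi -> tcontract xi x = 0) -> x = 0.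
Proof.
move=> /fin_dim_basis[n [e [xi Be]]] x0; rewrite (tcontract_expand x Be).
have [lxi _ _] := Be.
rewrite big1 // => i _; rewrite x0 //.
exact: lin0 ((tpure_bilin U V).1 (e i)).
Qed.

End Contraction.

(** Contraction commutes with morphisms acting on the other factor. *)
Lemma tcontract_manin (K : fieldType) (A A' B : gralg K) (f : grhom A A') k
    (xi : B k -> K^o) (x : manin A B k) :
  linear xi -> tcontract xi (manin_map f (grid B) k x) = f k (tcontract xi x).
Proof.
move=> lxi; elim/tens_ind: x => [a b|x y IHx IHy].
  by rewrite manin_mapE !tcontractE // (linZ (grfun_linear f (k := k))).
by rewrite grfunD !(linD (tcontract_linear lxi (U := _))) IHx IHy grfunD.
Qed.

(** * The internal cohomomorphism algebra *)

Section Cohom.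
Variables (K : fieldType) (W : lmodType K) (S : forall k, tensalg W k -> Prop).
Variables (B : gralg K) (n : nat) (e : 'I_n -> B 1) (eps : 'I_n -> B 1 -> K^o).
Hypotheses (basis_e : is_basis e eps) (fin_dimB : forall k, fin_dim (B k)).

(** The space [W^n], a model of [W ⊗ B_1^*] in the basis of [B_1^*] dual to [e]. *)
Definition cohom_gen : lmodType K := {ffun 'I_n -> W}.

(** The inclusion of [W] as the [i]-th summand of [W^n]. *)
Definition cohom_inj (i : 'I_n) (w : W) : cohom_gen :=
  [ffun j => if j == i then w else 0].

Lemma cohom_inj_linear i : linear (cohom_inj i).
Proof.
by move=> a u v; apply/ffunP => j; rewrite !ffunE; case: eqP; rewrite ?scaler0 ?addr0.
Qed.

Lemma cohom_gen_sum (u : cohom_gen) : u = \sum_i cohom_inj i (u i).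
Proof.
apply/ffunP => j; rewrite sum_ffunE (bigD1 j) //= ffunE eqxx big1 ?addr0 //.
by move=> i /negPf ij; rewrite ffunE eq_sym ij.
Qed.

Definition coact_gen (w : W) : manin (tensalg cohom_gen) B 1 :=
  \sum_i tensalg_gen (cohom_inj i w) ⊗ e i.

Lemma coact_gen_linear : linear coact_gen.
Proof.
move=> a u v; rewrite scaler_sumr -big_split; apply: eq_bigr => i _ /=.
by rewrite cohom_inj_linear tensalg_gen_linear !tpureE.
Qed.

(** The coaction before relations are imposed: the morphism from the tensor
    algebra of [W] that sends [w] to the sum of the [w_i ⊗ e_i]. *)
Definition coact_free : grhom (tensalg W) (manin (tensalg cohom_gen) B) :=
  tensalg_lift coact_gen_linear.

(** The relations forced by those of [S]: the contractions of the coaction of a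
    relation [s] against all functionals on the second factor. *)
Inductive cohom_rel k : tensalg cohom_gen k -> Prop :=
| CohomRel (xi : B k -> K^o) (s : tensalg W k) :
    linear xi -> S s -> cohom_rel (tcontract xi (coact_free k s)).

(** The internal cohomomorphism algebra of [TW/(S)] and [B]. *)
Definition cohom : gralg K := grquot cohom_rel.

Lemma coact_rel k (s : tensalg W k) : S s ->
  grcompose (manin_map (grquot_pi cohom_rel) (grid B)) coact_free k s = 0.
Proof.
move=> Ss; apply: tcontract_inj => // xi lxi.
rewrite grcomposeE tcontract_manin //; apply: grquot_pi_rel; exact: CohomRel.
Qed.

(** The coaction, the universal arrow from [TW/(S)] to [- ∘ B]. *)
Definition coact : grhom (grquot S) (manin cohom B) := grquot_lift coact_rel.

Lemma coact_genE (Z : gralg K) (f : grhom (tensalg cohom_gen) Z) w :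
  manin_map f (grid B) 1 (coact_free 1 (tensalg_gen w))
  = \sum_i f 1 (tensalg_gen (cohom_inj i w)) ⊗ e i.
Proof.
rewrite tensalg_liftE.
have lf := grfun_linear (manin_map f (grid B)) (k := 1).
rewrite (big_morph _ (linD lf) (lin0 lf)).
by apply: eq_bigr => i _; rewrite manin_mapE.
Qed.

(** The value of [f] on the [i]-th copy of [w] is the [i]-th coordinate of the
    image of [w], so [f] can be read off the composite. *)
Lemma coact_free_inj (Z : gralg K) (f g : grhom (tensalg cohom_gen) Z) :
  grcompose (manin_map f (grid B)) coact_free
  = grcompose (manin_map g (grid B)) coact_free -> f = g.
Proof.
move=> fg; apply: tensalg_homP => u.
have [leps _ dual] := basis_e.
have eq_inj i w : f 1 (tensalg_gen (cohom_inj i w)) = g 1 (tensalg_gen (cohom_inj i w)).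
  have contr (h : grhom (tensalg cohom_gen) Z) :
      h 1 (tensalg_gen (cohom_inj i w))
      = tcontract (eps i) (manin_map h (grid B) 1 (coact_free 1 (tensalg_gen w))).
    have lc := tcontract_linear (leps i) (U := Z 1).
    rewrite coact_genE (big_morph _ (linD lc) (lin0 lc)) (bigD1 i) //=.
    rewrite tcontractE // dual eqxx scale1r big1 ?addr0 // => j /negPf ji.
    by rewrite tcontractE // dual eq_sym ji scale0r.
  rewrite !contr; congr tcontract.
  exact: (congr1 (fun h : grhom _ (manin Z B) => h 1 (tensalg_gen w)) fg).
rewrite [u]cohom_gen_sum.
have ext (h : grhom (tensalg cohom_gen) Z) (v : cohom_gen) :
    h 1 (tensalg_gen (\sum_i cohom_inj i (v i)))
    = \sum_i h 1 (tensalg_gen (cohom_inj i (v i))).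
  have lg := @tensalg_gen_linear K cohom_gen.
  have lh := grfun_linear h (k := 1).
  by rewrite (big_morph _ (linD lg) (lin0 lg)) (big_morph _ (linD lh) (lin0 lh)).
by rewrite !ext; apply: eq_bigr => i _; apply: eq_inj.
Qed.

Lemma coact_pi (Z : gralg K) (g : grhom cohom Z) :
  grcompose (grcompose (manin_map g (grid B)) coact) (grquot_pi S)
  = grcompose (manin_map (grcompose g (grquot_pi cohom_rel)) (grid B)) coact_free.
Proof.
rewrite -grcomposeA grquot_liftE grcomposeA -manin_map_comp.
by rewrite grcompose_idl.
Qed.

Section Factor.
Variables (Z : gralg K) (h : grhom (grquot S) (manin Z B)).

(** The linear map from [W^n] to [Z_1] whose restriction to the [i]-th copy of
    [W] is the [i]-th coordinate of [h] on generators. *)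
Definition factor_gen (u : cohom_gen) : Z 1 :=
  \sum_i tcontract (eps i) (h 1 (grquot_pi S 1 (tensalg_gen (u i)))).

Lemma factor_gen_linear : linear factor_gen.
Proof.
have [leps _ _] := basis_e.
move=> a u v; rewrite scaler_sumr -big_split; apply: eq_bigr => i _ /=.
rewrite !ffunE tensalg_gen_linear grquot_pi_linear grfun_linear.
exact: tcontract_linear.
Qed.

(* The morphism from [T(W^n)] to [Z] that corresponds to [h]. *)
Let psi := tensalg_lift factor_gen_linear.

Let psi_coact :
  grcompose (manin_map psi (grid B)) coact_free = grcompose h (grquot_pi S).
Proof.
apply: tensalg_homP => w; rewrite grcomposeE coact_genE.
rewrite [RHS](tcontract_expand _ basis_e); apply: eq_bigr => i _; congr (_ ⊗ _).
have [leps _ _] := basis_e.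
rewrite tensalg_liftE /factor_gen (bigD1 i) //= ffunE eqxx big1 ?addr0 //.
move=> j /negPf ji; rewrite ffunE ji (lin0 (@tensalg_gen_linear K W)).
rewrite (lin0 (@grquot_pi_linear _ _ S 1)) (lin0 (grfun_linear h (k := 1))).
exact: lin0 (tcontract_linear (leps j) (U := Z 1)).
Qed.

Let psi_rel k (r : tensalg cohom_gen k) : cohom_rel r -> psi k r = 0.
Proof.
case=> xi s lxi Ss; rewrite -tcontract_manin //.
have -> : manin_map psi (grid B) k (coact_free k s) = h k (grquot_pi S k s).
  exact: (congr1 (fun g : grhom _ (manin Z B) => g k s) psi_coact).
rewrite grquot_pi_rel // (lin0 (grfun_linear h (k := k))).
exact: lin0 (tcontract_linear lxi (U := Z k)).
Qed.

Lemma coact_factor :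
  exists g : grhom cohom Z, grcompose (manin_map g (grid B)) coact = h.
Proof.
exists (grquot_lift psi_rel); apply: grquot_homP.
by rewrite coact_pi grquot_liftE psi_coact.
Qed.

End Factor.

Lemma coact_universal :
  universal_arrow (G := tensor_right (M := ManinSMC K) B) (Y := cohom) coact.
Proof.
move=> Z h; have [g gh] := coact_factor h; exists g => // g' g'h.
apply: grquot_homP; apply: coact_free_inj; rewrite -!coact_pi.
by congr (grcompose _ _); rewrite gh.
Qed.

End Cohom.

Lemma fin_dim_iso (K : fieldType) (A A' : gralg K) k :
  isomorphic (C := GrAlgCat K) A A' -> fin_dim (A' k) -> fin_dim (A k).
Proof.
move=> [f [g [gf _]]]; apply: (fin_dim_surj (grfun_linear g (k := k))) => a.
by exists ((f : grhom A A') k a); apply: (congr1 (fun h : grhom A A => h k a) gf).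
Qed.

Theorem theorem4p3 (K : fieldType) (charK : 2%N \notin [pchar K]) :
  coclosed_relative (ManinSMC K) (@FQA K).
Proof.
move=> B [V [R BR]]; apply: relative_adjoint_of_universal => A [W [S AS]].
apply: has_universal_arrow_iso AS _.
have fin_dimB k : fin_dim ((B : gralg K) k).
  exact: fin_dim_iso BR (fin_dim_quadalg R k).
have [n [e [eps basis_e]]] := fin_dim_basis (fin_dimB 1).
by exists (cohom (@quad_rel K W S) e); eexists; apply: coact_universal basis_e fin_dimB.
Qed.
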